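(* Let $\Phi=\{\phi_i:X\to X\}_{i\in I}$ be a contracting conformal iterated function system with countable index set $I$ and contraction constant $s\in(0,1)$, not assumed to satisfy the cone condition, and suppose that $|\phi_i'(x)|\le s$ for each $x\in X$ and each $i\in I$. Then $$\dim_H J(\Phi)=\inf\{\delta\ge 0: P(\delta)<0\}=\sup_{\Phi_F}\dim_H J(\Phi_F),$$ where $\Phi_F=\{\phi_i\}_{i\in F}$ runs over all subsystems of $\Phi$ with $F\subset I$ finite and non-empty.
   Context: A contracting conformal iterated function system (in the sense of Mauldin and Urbański, with the cone condition dropped) consists of a non-empty compact set $X\subset\mathbb R^d$, a countable index set $I$ and injective maps $\phi_i:X\to X$, $i\in I$, such that: (a) there is $s\in(0,1)$ with $|\phi_i(x)-\phi_i(y)|\le s|x-y|$ for all $x,y\in X$, $i\in I$; (b) (open set condition) $\operatorname{Int}X\neq\emptyset$, $\phi_i(\operatorname{Int}X)\subset\operatorname{Int}X$ for all $i$, and $\phi_i(\operatorname{Int}X)\cap\phi_j(\operatorname{Int}X)=\emptyset$ for $i\neq j$ (interior in $\mathbb R^d$); (c) there is an open connected set $V$ with $X\subset V\subset\mathbb R^d$ such that every $\phi_i$ extends to a $C^{1+\varepsilon}$ conformal diffeomorphism of $V$ into $V$; (d) (bounded distortion) there is $K\ge1$ such that $|\phi_\omega'(y)|\le K|\phi_\omega'(x)|$ for all finite words $\omega$ over $I$ and all $x,y\in V$, where $\phi_\omega=\phi_{\omega_1}\circ\cdots\circ\phi_{\omega_n}$ and $|\phi_\omega'(x)|$ is the operator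 norm of the derivative. The cone condition, which is NOT assumed, is the requirement that there exist $\gamma,l>0$ such that every point of $X$ is the vertex of an open cone of central angle $\gamma$ and altitude $l$ contained in the interior of $X$. The limit set is $J(\Phi)=\bigcup_{\omega\in I^{\mathbb N}}\bigcap_{n\ge1}\phi_{(\omega_1,\dots,\omega_n)}(X)$. The pressure function is $P(\delta)=\lim_{n\to\infty}\frac1n\log\sum_{\omega\in I^n}\sup_{x\in X}|\phi_\omega'(x)|^\delta\in\mathbb R\cup\{\infty\}$ for $\delta\ge0$. $\dim_H$ is Hausdorff dimension. *)

(* Defs.v *)
From HB Require Import structures.
From mathcomp Require Import all_boot all_order all_algebra.
From mathcomp Require Import all_classical all_reals all_analysis.

Set Implicit Arguments.
Unset Strict Implicit.
Unset Printing Implicit Defensive.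

Import Order.TTheory GRing.Theory Num.Theory.
Import numFieldNormedType.Exports.

Local Open Scope classical_set_scope.
Local Open Scope ring_scope.

(* The library norm `|x| on 'rV[R]_d is the sup norm.  It induces the usual
   topology and the usual notion of differentiability, so compact, interior,
   open, connected and 'd f x below are the Euclidean ones; every metric
   quantity (contraction, conformality, |phi'|, diameters) uses enorm. *)
Definition enorm (R : realType) (d : nat) (x : 'rV[R]_d) : R :=
  Num.sqrt (\sum_(i < d) x ord0 i ^+ 2).

Definition opnorm (R : realType) (d : nat) (f : 'rV[R]_d -> 'rV[R]_d) : R :=
  sup [set enorm (f v) | v in [set v | enorm v <= 1]].

(* C^{1+eps} regularity on an open set U: the derivative is locally
   eps-Hölder on U. *)
Definition C1eps (R : realType) (d : nat) (eps : R) (U : set 'rV[R]_d)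
    (f : 'rV[R]_d -> 'rV[R]_d) : Prop :=
  (forall x, U x -> differentiable f x) /\
  (forall x, U x -> exists (W : set 'rV[R]_d) (C : R), nbhs x W /\
    forall y z, U y -> U z -> W y -> W z ->
      opnorm (fun v => 'd f y v - 'd f z v) <= C * enorm (y - z) `^ eps).

(* Diffeomorphism of V onto an open subset of V. *)
Definition C1eps_diffeo_into (R : realType) (d : nat) (eps : R)
    (V : set 'rV[R]_d) (f : 'rV[R]_d -> 'rV[R]_d) : Prop :=
  [/\ f @` V `<=` V, open (f @` V), C1eps eps V f &
      exists2 g : 'rV[R]_d -> 'rV[R]_d,
        (forall x, V x -> g (f x) = x) & C1eps eps (f @` V) g].

(* Orientation-reversing maps are allowed. *)
Definition conformal_on (R : realType) (d : nat) (V : set 'rV[R]_d)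
    (f : 'rV[R]_d -> 'rV[R]_d) : Prop :=
  forall x, V x -> exists2 c : R, 0 < c &
    forall v, enorm ('d f x v) = c * enorm v.

(* phi_{w_1} o ... o phi_{w_n} *)
Definition word_map (T I : Type) (phi : I -> T -> T) (w : seq I) : T -> T :=
  foldr (fun i f => phi i \o f) id w.

(* phi i stands at once for the map X -> X and for its extension V -> V, since
   derivatives at points of X are those of the extension (which the map on X
   need not determine).  Its values outside V are irrelevant. *)
Record contracting_cifs (R : realType) (d : nat) (I : Type)
    (X V : set 'rV[R]_d) (phi : I -> 'rV[R]_d -> 'rV[R]_d) (s : R) : Prop := {
  cifs_nonempty : X !=set0;
  cifs_compact : compact X;
  cifs_maps : forall i, phi i @` X `<=` X;
  cifs_inj : forall i, set_inj X (phi i);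
  cifs_s01 : 0 < s < 1;
  cifs_contract : forall i x y, X x -> X y ->
    enorm (phi i x - phi i y) <= s * enorm (x - y);
  cifs_int : X° !=set0;
  cifs_osc_sub : forall i, phi i @` X° `<=` X°;
  cifs_osc_disj : forall i j, i <> j ->
    (phi i @` X°) `&` (phi j @` X°) = set0;
  cifs_V_open : open V;
  cifs_V_connected : connected V;
  cifs_XV : X `<=` V;
  cifs_diffeo : exists eps : R, 0 < eps <= 1 /\
    forall i, C1eps_diffeo_into eps V (phi i) /\ conformal_on V (phi i);
  cifs_distortion : exists2 K : R, 1 <= K &
    forall (w : seq I) x y, V x -> V y ->
      opnorm ('d (word_map phi w) y) <= K * opnorm ('d (word_map phi w) x)
}.

Definition subsystem (T : Type) (I : choiceType) (phi : I -> T -> T)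
    (F : set I) : F -> T -> T := fun i => phi (val i).

Definition limit_set (T I : Type) (X : set T) (phi : I -> T -> T) : set T :=
  \bigcup_(w in [set: nat -> I]) \bigcap_(n in [set n : nat | (1 <= n)%N])
    (word_map phi (mkseq w n) @` X).

Definition pressure_sum (R : realType) (d : nat) (I : countType)
    (X : set 'rV[R]_d) (phi : I -> 'rV[R]_d -> 'rV[R]_d) (delta : R) (n : nat) :
    \bar R :=
  (\esum_(w in [set: n.-tuple I])
     ereal_sup [set (opnorm ('d (word_map phi w) x) `^ delta)%:E | x in X])%E.

Definition pressure (R : realType) (d : nat) (I : countType)
    (X : set 'rV[R]_d) (phi : I -> 'rV[R]_d -> 'rV[R]_d) (delta : R) : \bar R :=
  limn (fun n : nat => ((n%:R^-1)%:E * lne (pressure_sum X phi delta n))%E).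

Definition ediam (R : realType) (d : nat) (U : set 'rV[R]_d) : \bar R :=
  ereal_sup [set (enorm (xy.1 - xy.2))%:E | xy in U `*` U].

(* The empty set has weight 0 also for delta = 0, whereas 0 `^ 0 = 1. *)
Definition hausdorff_weight (R : realType) (d : nat) (delta : R)
    (U : set 'rV[R]_d) : \bar R :=
  if U == set0 then 0%E else poweR (ediam U) delta.

Definition hausdorff_premeasure (R : realType) (d : nat) (delta r : R)
    (A : set 'rV[R]_d) : \bar R :=
  ereal_inf [set (\sum_(0 <= k <oo) hausdorff_weight delta (U k))%E |
    U in [set U : nat -> set 'rV[R]_d |
      A `<=` \bigcup_k U k /\ forall k, (ediam (U k) <= r%:E)%E]].

Definition hausdorff_measure (R : realType) (d : nat) (delta : R)
    (A : set 'rV[R]_d) : \bar R :=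
  ereal_sup [set hausdorff_premeasure delta r A | r in [set r : R | 0 < r]].

Definition hausdorff_dim (R : realType) (d : nat) (A : set 'rV[R]_d) : \bar R :=
  ereal_inf [set delta%:E |
    delta in [set delta : R | 0 <= delta /\ hausdorff_measure delta A = 0%E]].

(* Main.v *)
Require Import Defs.
From HB Require Import structures.
From mathcomp Require Import all_boot all_order all_algebra.
From mathcomp Require Import all_classical all_reals all_analysis.
From mathcomp Require Import ring lra.

(* Write h = inf {delta >= 0 : P(delta) < 0}.

   dim J <= h: bounded distortion, propagated through the connected set V, gives
   diam phi_w(X) <= C |phi_w'|, so the cylinders of length n cover J with total
   delta-weight at most C^delta Z_n(delta), which tends to 0 if P(delta) < 0.

   h <= sup_F dim J(Phi_F): let delta < h.  Were the sums Z_n(delta) bounded,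
   |phi_w'| <= s^n would give P < 0 just above delta, since P is a limit by
   Fekete's lemma.  Hence for some n a finite set of n-words has a sum as large
   as we like, and the system of the corresponding maps has lower derivative
   bounds c_t with sum c_t^delta >= 1.  A Bernoulli weight on it gives a cylinder
   u mass at most |phi_u'|^delta.  By the open set condition, the cylinders whose
   derivative first drops below rho contain disjoint balls of radius comparable
   to rho, so boundedly many of them meet a set of diameter rho, and the mass
   distribution principle bounds the delta-dimensional measure from below.  Only
   finite systems occur here, which is why no cone condition is needed.

   Constants are irrelevant to both bounds, so distances are estimated in the sup
   norm, which the library provides. *)

Set Implicit Arguments.
Unset Strict Implicit.
Unset Printing Implicit Defensive.

Import Order.TTheory GRing.Theory Num.Theory.
Import numFieldNormedType.Exports.

Local Open Scope classical_set_scope.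
Local Open Scope ring_scope.

(** * Norms and differentiable maps of R^d *)

Section EuclideanNorm.
Context {R : realType} {d : nat}.
Implicit Types x y v : 'rV[R]_d.

Lemma enorm_ge0 x : 0 <= enorm x.
Proof. exact: sqrtr_ge0. Qed.

Lemma normr_coord_le x i : `|x ord0 i| <= `|x|.
Proof.
rewrite [leRHS]/Num.Def.normr/= mx_normrE.
by apply: (le_bigmax _ (fun ij : 'I_1 * 'I_d => `|x ij.1 ij.2|) (ord0, i)).
Qed.

Lemma normr_le_coord x (c : R) : 0 <= c ->
  (forall i, `|x ord0 i| <= c) -> `|x| <= c.
Proof.
move=> c0 h; rewrite /Num.Def.normr/= mx_normrE.
by apply/bigmax_leP; split => // -[i j] _ /=; rewrite (ord1 i); exact: h.
Qed.

Lemma normr_le_enorm x : `|x| <= enorm x.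
Proof.
apply: normr_le_coord; first exact: enorm_ge0.
move=> i; rewrite -sqrtr_sqr /enorm ler_sqrt ?sumr_ge0//.
- by rewrite (bigD1 i)//= lerDl sumr_ge0// => j _; exact: sqr_ge0.
- by move=> j _; exact: sqr_ge0.
Qed.

Lemma enorm_le_normr x : enorm x <= d%:R * `|x|.
Proof.
have -> : d%:R * `|x| = Num.sqrt ((d%:R * `|x|) ^+ 2).
  by rewrite sqrtr_sqr ger0_norm// mulr_ge0.
rewrite /enorm ler_sqrt ?sqr_ge0//.
apply: (@le_trans _ _ (\sum_(i < d) `|x| ^+ 2)).
  apply: ler_sum => i _; rewrite -[leLHS]real_normK ?num_real//.
  by rewrite ler_pXn2r ?nnegrE//; exact: normr_coord_le.
rewrite sumr_const card_ord -[X in X <= _]mulr_natl exprMn ler_wpM2r ?sqr_ge0//.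
by rewrite -natrX ler_nat; case: (d) => // n; rewrite leq_pmulr.
Qed.

Lemma enorm0 : enorm (0 : 'rV[R]_d) = 0.
Proof.
by apply/le_anti; rewrite enorm_ge0 (le_trans (enorm_le_normr _))// normr0 mulr0.
Qed.

(** The supremum is attained at a unit vector, which exists only in positive dimension; hence
    [hd]. *)
Lemma opnorm_similarity (hd : (0 < d)%N) (f : 'rV[R]_d -> 'rV[R]_d) c :
  0 <= c -> (forall v, enorm (f v) = c * enorm v) -> opnorm f = c.
Proof.
move=> c0 fc.
have e1 : enorm (delta_mx ord0 (Ordinal hd) : 'rV[R]_d) = 1.
  rewrite /enorm (bigD1 (Ordinal hd))//= big1 ?addr0; last first.
    by move=> i ine; rewrite mxE (negbTE ine) andbF expr0n.
  by rewrite mxE !eqxx expr1n sqrtr1.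
apply/le_anti/andP; split.
- apply: ge_sup; first by exists (enorm (f 0)), 0 => //=; rewrite enorm0 ler01.
  by move=> _ [v /= v1 <-]; rewrite fc ler_piMr.
- apply: ub_le_sup.
    by exists c => _ [v /= v1 <-]; rewrite fc ler_piMr.
  by exists (delta_mx ord0 (Ordinal hd)); rewrite /= ?e1// fc e1 mulr1.
Qed.

End EuclideanNorm.

Lemma continuous_penalized_dist (R : realType) (U W : normedModType R)
    (f : U -> W) (a x : U) (y : W) (m : R) : {for x, continuous f} ->
  {for x, continuous (fun z => `|f z - y| + m * `|z - a|)}.
Proof.
move=> fx; apply: cvgD.
  by apply: cvg_norm; apply: cvgB => //; exact: cvg_cst.
apply: cvgMl_tmp; apply: cvg_norm; apply: cvgB; [exact: cvg_id|exact: cvg_cst].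
Qed.

Section Calculus.
Context {R : realType} {d : nat}.
Implicit Types (f : 'rV[R]_d -> 'rV[R]_d) (a x y v : 'rV[R]_d) (r : R).

Lemma is_derive_line f a v (t : R) : differentiable f (a + t *: v) ->
  is_derive t 1 (fun u : R => f (a + u *: v)) ('d f (a + t *: v) v).
Proof.
move=> df.
have E : (fun h : R => h^-1 *: (((fun u : R => f (a + u *: v)) \o shift t) (h *: 1)
      - f (a + t *: v))) =
    (fun h : R => h^-1 *: ((f \o shift (a + t *: v)) (h *: v) - f (a + t *: v))).
  apply/funext => h; congr (_ *: (f _ - _)).
  by rewrite /= /shift/= [h *: 1]mulr1 scalerDl addrCA.
apply: DeriveDef; first by rewrite /derivable E; exact: diff_derivable.
by rewrite /derive E -deriveE.
Qed.

(** The scalar mean value theorem is applied to each coordinate along the segment from a to y; in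
    the sup norm the coordinate bounds give the vector bound with the same L. *)
Lemma mean_value_ball f a r (L : R) :
  (forall z, ball a r z -> differentiable f z) ->
  (forall z v, ball a r z -> `|'d f z v| <= L * `|v|) ->
  forall y, ball a r y -> `|f y - f a| <= L * `|y - a|.
Proof.
move=> df dL y ay.
have r0 : 0 < r by move: ay; rewrite -ball_normE/=; exact: le_lt_trans.
have L0 : 0 <= L * `|y - a|.
  by apply: le_trans (dL a (y - a) (ballxx _ r0)).
apply: normr_le_coord => // i.
pose h (t : R) : R := (f (a + t *: (y - a))) ord0 i.
pose dh (t : R) : R := ('d f (a + t *: (y - a)) (y - a)) ord0 i.
have seg (t : R) : t \in `[0, 1] -> ball a r (a + t *: (y - a)).
  rewrite in_itv/= => /andP[t0 t1]; move: ay.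
  rewrite -!ball_normE/= opprD addNKr normrN normrZ (ger0_norm t0) => ay.
  by rewrite (le_lt_trans _ ay)// distrC ler_piMl.
have hdh (t : R) : t \in `[0, 1] -> is_derive t 1 h (dh t).
  move=> t01; have [D1 D2] := is_derive_line (df _ (seg _ t01)).
  apply: DeriveDef; first by move/derivable_mxP : D1; exact.
  by rewrite /dh -D2 derive_mx// mxE.
have dh_oo (t : R) : t \in `]0, 1[ -> is_derive t 1 h (dh t).
  by move=> t01; apply: hdh; exact: subset_itv_oo_cc t01.
have ch : {within `[0, 1], continuous h}.
  by apply: derivable_within_continuous => t /hdh[].
have [c c01 hc] := MVT_segment ler01 dh_oo ch.
have -> : (f y - f a) ord0 i = h 1 - h 0.
  by rewrite /h scale1r scale0r addr0 (addrC a) subrK !mxE.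
rewrite hc subr0 mulr1.
by apply: le_trans (normr_coord_le _ _) _; exact/dL/seg.
Qed.

Lemma linear_inj_surj (f : {linear 'rV[R]_d -> 'rV[R]_d}) :
  (forall v, f v = 0 -> v = 0) -> forall w, exists v, f v = w.
Proof.
move=> inj w.
have fM v : v *m lin1_mx f = f v by rewrite mul_rV_lin1.
have : lin1_mx f \in unitmx.
  rewrite -row_free_unit -kermx_eq0; apply/eqP/row_matrixP => i.
  rewrite row0; apply: inj; rewrite -fM -row_mul mulmx_ker row0.
  by [].
by move=> u; exists (w *m invmx (lin1_mx f)); rewrite -fM mulmxKV.
Qed.

(* No inverse function theorem is needed: a minimiser of
   |f x - y| + (m / 2) |x - a| over the closed ball is interior by the choice of
   y, and moving from it towards y would decrease the functional. *)
Lemma image_ball_contains_ball f a r (m : R) : 0 < r -> 0 < m ->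
  (forall x, `|x - a| <= r -> differentiable f x) ->
  (forall x v, `|x - a| <= r -> m * `|v| <= `|'d f x v|) ->
  forall y, `|f a - y| < m * r / 2 -> exists2 x, `|x - a| < r & f x = y.
Proof.
move=> r0 m0 df dm y hy.
pose A := [set x | `|x - a| <= r].
pose h x := `|f x - y| + m / 2 * `|x - a|.
have AE : A = closed_ball a r.
  by rewrite closed_ballE//; apply/seteqP; split=> x; rewrite /closed_ball_/= distrC.
have Aa : A a by rewrite /A/= subrr normr0 ltW.
have cA : compact A.
  apply: bounded_closed_compact; last by rewrite AE; exact: closed_ball_closed.
  exists (`|a| + r); split; first exact: num_real.
  move=> M aM x /= xA; apply: ltW; apply: le_lt_trans aM.
  by rewrite -[x](subrK a) (le_trans (ler_normD _ _))// addrC lerD2l.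
have ch : {within A, continuous h}.
  apply: continuous_in_subspaceT => x /set_mem /df/differentiable_continuous fx.
  exact: continuous_penalized_dist.
have [x /set_mem xA xmin] := EVT_min_rV (ex_intro _ a Aa) cA ch.
have hx : h x <= `|f a - y|.
  apply: le_trans (xmin a _) _; first exact/mem_set.
  by rewrite /h subrr normr0 mulr0 addr0.
have m2 : 0 < m / 2 by rewrite divr_gt0.
(* The penalty term alone is at most h x, hence below m r / 2. *)
have xr : `|x - a| < r.
  rewrite -(ltr_pM2l m2) (mulrAC m _ r); apply: le_lt_trans hy.
  by apply: le_trans hx; rewrite /h lerDr.
exists x => //; apply/eqP; rewrite -subr_eq0; apply/negPn/negP => e0.
set e := f x - y in e0.
have e_gt0 : 0 < `|e| by rewrite normr_gt0.
(* The Newton direction: moving along v cancels e to first order, and |v| is at most |e| / m. *)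
have [v dv] : exists v, 'd f x v = - e.
  apply: linear_inj_surj => v dv0; have := dm x v xA.
  by rewrite dv0 normr0 pmulr_rle0// normr_le0 => /eqP.
have mv : m * `|v| <= `|e| by rewrite -(normrN e) -dv; exact: dm.
have e4 : 0 < `|e| / 4 by rewrite divr_gt0.
have dvE : 'D_v f x = - e by rewrite deriveE ?dv//; exact: df.
have cv : h0^-1 *: ((f \o shift x) (h0 *: v) - f x) @[h0 --> 0^'] --> - e.
  by rewrite -dvE; exact: diff_derivable (df x xA).
have [eps /= eps0 H] := (nbhs_ballP _ _).1 (cvgr_dist_lt _ _ cv _ e4).
(* [t <= q] keeps x + t v in the ball, and [t < eps] brings the difference quotient within |e| / 4
   of -e. *)
pose q := (r - `|x - a|) / (`|v| + 1).
have q0 : 0 < q by rewrite divr_gt0 ?subr_gt0// ltr_wpDl.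
pose t := Num.min (eps / 2) (Num.min 1 (q / 2)).
have t0 : 0 < t by rewrite !lt_min ltr01 (divr_gt0 eps0)// (divr_gt0 q0).
have t1 : t <= 1 by rewrite !ge_min lexx orbT.
have teps : t < eps by rewrite gt_min ltr_pdivrMr// ltr_pMr// ltr1n.
have tq : t <= q.
  rewrite !ge_min; apply/orP; right; apply/orP; right.
  by rewrite ler_pdivrMr// ler_peMr ?ler1n// ltW.
have tv : t * `|v| <= r - `|x - a|.
  apply: (@le_trans _ _ (t * (`|v| + 1))); first by rewrite ler_pM2l// lerDl.
  by rewrite -ler_pdivlMr ?ltr_wpDl.
have := H t; rewrite -ball_normE/= sub0r normrN gtr0_norm// => /(_ teps).
rewrite gt_eqF// => /(_ isT) Ht.
pose z := t *: v + x.
have zA : A z.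
  rewrite /A/= /z -addrA (le_trans (ler_normD _ _))// normrZ gtr0_norm//.
  by rewrite -lerBrDr.
have fz : `|f z - y| <= (1 - t) * `|e| + t * (`|e| / 4).
  have -> : f z - y = (1 - t) *: e - t *: (- e - t^-1 *: (f z - f x)).
    rewrite (scalerBr t (- e)) scalerA divff ?gt_eqF// scale1r scalerBl scale1r.
    by rewrite scalerN opprB opprK (addrC (f z - f x)) addrA subrK addrC subrKA.
  apply: le_trans (ler_normB _ _) _.
  rewrite !normrZ (gtr0_norm t0) ger0_norm ?subr_ge0// lerD2l ler_pM2l//.
  exact: ltW.
have za : `|z - a| <= `|x - a| + t * `|v|.
  by rewrite /z -addrA (le_trans (ler_normD _ _))// normrZ gtr0_norm// [leLHS]addrC.
(* From x to z the distance to y drops by at least 3 t |e| / 4, while the penalty grows by at most t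
   |e| / 2, contradicting minimality. *)
have := xmin z (mem_set zA); rewrite /h -/e => hz.
have tmv : t * (m * `|v|) <= t * `|e| by rewrite ler_pM2l.
have te : 0 < t * `|e| by rewrite mulr_gt0.
have mza : m * `|z - a| <= m * (`|x - a| + t * `|v|) by rewrite ler_pM2l.
nra.
Qed.

End Calculus.

(** * Conformal systems *)

(* Unlike contracting_cifs, which asks for Hölder derivatives and C^1 inverses,
   these properties pass at once to systems of compositions of the maps. *)
Record conformal_system (R : realType) (d : nat) (I : Type)
    (X V : set 'rV[R]_d) (phi : I -> 'rV[R]_d -> 'rV[R]_d) (s K : R) : Prop := {
  cs_dim : (0 < d)%N;
  cs_compact : compact X;
  cs_int : X° !=set0;
  cs_maps : forall i x, X x -> X (phi i x);
  cs_inj : forall i, set_inj X (phi i);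
  cs_s01 : 0 < s < 1;
  cs_contract : forall i x y, X x -> X y ->
    enorm (phi i x - phi i y) <= s * enorm (x - y);
  cs_osc_sub : forall i x, X° x -> X° (phi i x);
  cs_osc_disj : forall i j x y, i <> j -> X° x -> X° y -> phi i x <> phi j y;
  cs_V_open : open V;
  cs_V_connected : connected V;
  cs_XV : X `<=` V;
  cs_V_maps : forall i x, V x -> V (phi i x);
  cs_diff : forall i x, V x -> differentiable (phi i) x;
  cs_conformal : forall i, conformal_on V (phi i);
  cs_K1 : 1 <= K;
  cs_distortion : forall (w : seq I) x y, V x -> V y ->
    opnorm ('d (word_map phi w) y) <= K * opnorm ('d (word_map phi w) x);
  cs_deriv : forall i x, X x -> opnorm ('d (phi i) x) <= s
}.

Lemma word_map_cat (T I : Type) (phi : I -> T -> T) u v :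
  word_map phi (u ++ v) = word_map phi u \o word_map phi v.
Proof. by elim: u => //= i u ->. Qed.

(** The relation under which the open set condition separates cylinders, see [word_map_disjoint]. *)
Definition incomparable (I : eqType) (u v : seq I) :=
  ~~ prefix u v && ~~ prefix v u.

Lemma incomparable_split (I : eqType) (u v : seq I) : incomparable u v ->
  exists p i j u' v', [/\ i <> j, u = p ++ i :: u' & v = p ++ j :: v'].
Proof.
elim: u v => [|i u IH] [|j v]; rewrite /incomparable ?prefix0s// ?andbF// !prefix_cons.
have [->|/eqP ij _] := eqVneq i j; last by exists [::], i, j, u, v.
by move=> /IH[p [k [l [u' [v' [kl -> ->]]]]]]; exists (j :: p), k, l, u', v'.
Qed.

Lemma diff_idE (R : realType) (U : normedModType R) (x v : U) : 'd id x v = v.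
Proof. by rewrite diff_val. Qed.

Section ConformalSystem.
Context {R : realType} {d : nat} {I : Type}.
Context {X V : set 'rV[R]_d} {phi : I -> 'rV[R]_d -> 'rV[R]_d} {s K : R}.
Context (H : conformal_system X V phi s K).
Implicit Types (u v w : seq I).

Local Notation D w x := (opnorm ('d (word_map phi w) x)).
Let hd := cs_dim H.

Let s0 : 0 < s. Proof. by have /andP[] := cs_s01 H. Qed.
Let K0 : 0 < K. Proof. exact: lt_le_trans ltr01 (cs_K1 H). Qed.

Lemma word_map_V w x : V x -> V (word_map phi w x).
Proof. by move=> Vx; elim: w => //= i w; exact: (cs_V_maps H). Qed.

Lemma word_map_X w x : X x -> X (word_map phi w x).
Proof. by move=> Xx; elim: w => //= i w; exact: (cs_maps H). Qed.

Lemma word_map_int w x : X° x -> X° (word_map phi w x).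
Proof. by move=> Xx; elim: w => //= i w; exact: (cs_osc_sub H). Qed.

Lemma word_map_inj w : set_inj X (word_map phi w).
Proof.
elim: w => [|i w IH] x y Xx Xy //= e.
apply: IH => //; apply: (cs_inj H) e; apply/mem_set/word_map_X/set_mem => //.
Qed.

Lemma word_map_diff w x : V x -> differentiable (word_map phi w) x.
Proof.
move=> Vx; elim: w => [|i w IH] /=; first exact: ex_diff.
by apply: differentiable_comp => //; apply: (cs_diff H); exact: word_map_V.
Qed.

Lemma word_map_conformal w : conformal_on V (word_map phi w).
Proof.
move=> x Vx; elim: w => [|i w [c c0 IH]] /=.
  by exists 1 => // v; rewrite mul1r diff_idE.
have [b b0 bE] := @cs_conformal _ _ _ _ _ _ _ _ H i _ (word_map_V w Vx).
exists (b * c) => [|v]; first exact: mulr_gt0.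
rewrite diff_comp/=; last 2 first.
- exact: word_map_diff.
- by apply: (cs_diff H); exact: word_map_V.
by rewrite bE IH mulrA.
Qed.

Lemma opnorm_word_gt0 w x : V x -> 0 < D w x.
Proof.
move=> Vx; have [c c0 cE] := word_map_conformal w Vx.
by rewrite (opnorm_similarity hd (ltW c0) cE).
Qed.

Lemma diff_word_enorm w x (v : 'rV[R]_d) : V x ->
  enorm ('d (word_map phi w) x v) = D w x * enorm v.
Proof.
move=> Vx; have [c c0 cE] := word_map_conformal w Vx.
by rewrite (opnorm_similarity hd (ltW c0) cE).
Qed.

Lemma opnorm_nil x : D [::] x = 1.
Proof. by apply: (opnorm_similarity hd) => // v; rewrite mul1r diff_idE. Qed.

(** Derivatives are similarities, so their ratios multiply exactly; lower bounds on derivatives of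
    words can thus be computed letter by letter, as well as upper ones. *)
Lemma opnorm_cat u v x : V x -> D (u ++ v) x = D u (word_map phi v x) * D v x.
Proof.
move=> Vx; have Vvx := word_map_V v Vx.
apply: (opnorm_similarity hd).
  by rewrite mulr_ge0// ltW// opnorm_word_gt0.
have E := diff_comp (word_map_diff v Vx) (word_map_diff u Vvx).
move=> t; rewrite word_map_cat.
have -> : 'd (word_map phi u \o word_map phi v) x t =
    'd (word_map phi u) (word_map phi v x) ('d (word_map phi v) x t).
  exact: (congr1 (fun f => f t) E).
by rewrite (diff_word_enorm u _ Vvx) (diff_word_enorm v _ Vx) mulrA.
Qed.

Lemma opnorm_word_le w x : X x -> D w x <= s ^+ size w.
Proof.
move=> Xx; elim: w => [|i w IH]; first by rewrite opnorm_nil expr0.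
rewrite -cat1s opnorm_cat; last exact: cs_XV H _ Xx.
have Vx := cs_XV H Xx; have Vwx := word_map_V w Vx.
rewrite exprS; apply: ler_pM => //; try exact/ltW/opnorm_word_gt0.
by apply: (cs_deriv H); exact: word_map_X.
Qed.

Lemma word_map_contract w x y : X x -> X y ->
  enorm (word_map phi w x - word_map phi w y) <= s ^+ size w * enorm (x - y).
Proof.
move=> Xx Xy; elim: w => [|i w IH]; first by rewrite expr0 mul1r.
rewrite exprS -mulrA; apply: le_trans (cs_contract H _ _ _) _.
- exact: word_map_X.
- exact: word_map_X.
by rewrite ler_pM2l.
Qed.

(** The radius depends only on the distance from a to the complement of V. Distortion bounds the
    derivative on the ball by K times that at [x0], uniformly in w, and the mean value inequality
    integrates this; d comes from comparing the two norms. *)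
Lemma local_oscillation a : V a -> exists2 r, 0 < r &
  forall x, ball a r x -> V x /\ forall w x0, V x0 ->
    `|word_map phi w x - word_map phi w a| <= K * d%:R * r * D w x0.
Proof.
move=> Va.
have /nbhs_ballP[r /= r0 rV] : nbhs a V by apply: open_nbhs_nbhs; split=> //; exact: cs_V_open H.
exists r => // x ax; split; first exact: rV.
move=> w x0 Vx0.
have dr0 : 0 <= K * d%:R * D w x0.
  by rewrite !mulr_ge0// ltW// opnorm_word_gt0.
apply: (@le_trans _ _ (K * d%:R * D w x0 * `|x - a|)).
  apply: (mean_value_ball (r := r)) => // [z /rV|z v /rV Vz].
    exact: word_map_diff.
  apply: le_trans (normr_le_enorm _) _; rewrite diff_word_enorm//.
  rewrite (_ : K * _ * _ * _ = K * D w x0 * (d%:R * `|v|)); last by ring.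
  apply: ler_pM; rewrite ?enorm_ge0//.
  - exact/ltW/opnorm_word_gt0.
  - exact: (cs_distortion H).
  - exact: enorm_le_normr.
rewrite -(mulrA _ r) (mulrC r) mulrA ler_wpM2l// ltW//.
by move: ax; rewrite -ball_normE/= distrC.
Qed.

(* The set of points comparable to x0 is clopen in V. *)
Lemma oscillation x0 : V x0 -> forall a, V a -> exists L, forall w,
  `|word_map phi w a - word_map phi w x0| <= L * D w x0.
Proof.
move=> Vx0.
pose E := [set a | V a /\ exists L, forall w,
  `|word_map phi w a - word_map phi w x0| <= L * D w x0].
(* On a small ball membership in E passes between any two points, so both E and its complement in V
   are open. *)
have propag a : V a -> exists2 r, 0 < r & forall x y, ball a r x -> ball a r y ->
    E x -> E y.
  move=> Va; have [r r0 rE] := local_oscillation Va; exists r => // x y ax ay.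
  move=> [Vx [L hL]]; have [_ ex] := rE _ ax; have [Vy ey] := rE _ ay.
  split=> //; exists (K * d%:R * r + K * d%:R * r + L) => w.
  rewrite !mulrDl.
  rewrite (_ : _ - _ = (word_map phi w y - word_map phi w a) +
    (word_map phi w a - word_map phi w x) +
    (word_map phi w x - word_map phi w x0)); last by rewrite !addrA !subrK.
  do 2 (apply: le_trans (ler_normD _ _) _; apply: lerD => //).
  - exact: ey.
  - by rewrite distrC; exact: ex.
have Vo := cs_V_open H.
suff EV : E = V by move=> a; rewrite -EV => -[].
apply: (cs_V_connected H).
- by exists x0; split=> //; exists 0 => w; rewrite subrr normr0 mul0r.
- exists E; last by apply/seteqP; split=> [x Ex|x []//]; split=> //; case: Ex.
  rewrite openE => a Ea; have [r r0 rE] := propag a Ea.1.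
  apply/nbhs_ballP; exists r => //= y ay.
  by apply: rE Ea => //; exact: ballxx.
- exists (~` (V `\` E)); last first.
    apply/seteqP; split=> [x Ex|x [Vx xE]].
      by split; [case: Ex|move=> [_]; exact].
    by apply: contrapT => nE; apply: xE.
  apply: open_closedC; rewrite openE => a [Va nEa].
  have [r r0 rE] := propag a Va.
  have /nbhs_ballP[q /= q0 qV] : nbhs a V by apply: open_nbhs_nbhs.
  apply/nbhs_ballP; exists (Num.min q r) => /=; first by rewrite lt_min q0.
  move=> y ay; split; first by apply: qV; apply: le_ball ay; rewrite ge_min lexx.
  move=> Ey; apply: nEa; apply: rE Ey; last exact: ballxx.
  by apply: le_ball ay; rewrite ge_min lexx orbT.
Qed.

Lemma word_map_diam x0 : V x0 -> exists2 C, 0 < C & forall w x y, X x -> X y ->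
  `|word_map phi w x - word_map phi w y| <= C * D w x0.
Proof.
move=> Vx0.
(* Compactness in near-covering form turns the constants at single points into one constant N for
   all of X. *)
have near_cov := (compact_near_coveringP X).1 (cs_compact H).
have : \forall n \near \oo, X `<=` [set x | forall w,
    `|word_map phi w x - word_map phi w x0| <= n%:R * D w x0].
  apply: near_cov => a Xa; have Va := cs_XV H Xa.
  have [L hL] := oscillation Vx0 Va.
  have [r r0 rE] := local_oscillation Va.
  exists (ball a r, [set n : nat | K * d%:R * r + L <= n%:R]).
    split=> /=; first exact: nbhsx_ballx.
    exact: nbhs_infty_ger.
  move=> [x n] /= [ax hn] w; have [_ ex] := rE _ ax.
  apply: (@le_trans _ _ ((K * d%:R * r + L) * D w x0)); last first.
    by rewrite ler_wpM2r// ltW// opnorm_word_gt0.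
  rewrite mulrDl -(subrKA (word_map phi w a)).
  by apply: le_trans (ler_normD _ _) _; apply: lerD => //; exact: ex.
move=> [N _ /(_ N (leqnn N)) hN].
exists (N%:R + N%:R + 1) => [|w x y Xx Xy]; first by rewrite ltr_wpDl.
rewrite -(subrKA (word_map phi w x0)) !mulrDl mul1r.
apply: le_trans (ler_normD _ _) _; apply: ler_wpDr.
  exact/ltW/opnorm_word_gt0.
by apply: lerD; [exact: hN|rewrite distrC; exact: hN].
Qed.

(** By distortion the derivative of every word expands vectors by at least a fixed multiple of its
    norm at [x1], so [image_ball_contains_ball] applies uniformly in w. *)
Lemma word_map_inner x1 : X° x1 -> exists2 c, 0 < c &
  forall w y, `|word_map phi w x1 - y| < c * D w x1 ->
    exists2 x, X° x & word_map phi w x = y.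
Proof.
move=> Xx1.
have /nbhs_ballP[r /= r0 rX] : nbhs x1 X°.
  by apply: open_nbhs_nbhs; split=> //; exact: open_interior.
have VX x : `|x - x1| <= r / 2 -> X° x.
  move=> h; apply: rX; rewrite -ball_normE/= distrC (le_lt_trans h)//.
  by rewrite ltr_pdivrMr// ltr_pMr// ltr1n.
have XV x : X° x -> V x by move/interior_subset; exact: (cs_XV H).
(* This is the radius in [image_ball_contains_ball] for the ball of radius r / 2 and m = D w x1 / (K
   d), divided by D w x1. *)
exists ((K * d%:R)^-1 * (r / 2) / 2).
  by rewrite !mulr_gt0// ?invr_gt0 ?mulr_gt0 ?ltr0n.
move=> w y hy.
have [|||||x xr <-] := @image_ball_contains_ball _ _ (word_map phi w) x1 (r / 2)
    ((K * d%:R)^-1 * D w x1) _ _ _ _ y.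
- by rewrite divr_gt0.
- by rewrite mulr_gt0 ?opnorm_word_gt0 ?invr_gt0 ?mulr_gt0 ?ltr0n//; exact: XV.
- by move=> x /VX /XV; exact: word_map_diff.
- move=> x v /VX /XV Vx; rewrite -mulrA ler_pdivrMl ?mulr_gt0 ?ltr0n//.
  apply: (@le_trans _ _ (K * enorm ('d (word_map phi w) x v))); last first.
    by rewrite -mulrA ler_pM2l// enorm_le_normr.
  have h0 : 0 <= D w x1 by apply/ltW/opnorm_word_gt0; exact: XV.
  have h1 : D w x1 <= K * D w x by apply: (cs_distortion H) => //; exact: XV.
  have h3 := diff_word_enorm w v Vx.
  apply: (@le_trans _ _ (K * D w x * enorm v)).
    by apply: (ler_pM h0 _ h1); [exact: normr_ge0|exact: normr_le_enorm].
  by rewrite h3 -mulrA.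
- apply: (lt_le_trans hy); rewrite le_eqVlt; apply/orP; left; apply/eqP.
  by move: (K * d%:R)^-1 (opnorm _) => A B; ring.
- by exists x => //; apply/VX/ltW.
Qed.

End ConformalSystem.

(** Injectivity on X cancels the common prefix; the open set condition then applies to the first
    letters that differ. *)
Lemma word_map_disjoint (R : realType) (d : nat) (I : eqType)
    (X V : set 'rV[R]_d) (phi : I -> 'rV[R]_d -> 'rV[R]_d) (s K : R) u v x y :
  conformal_system X V phi s K -> incomparable u v -> X° x -> X° y ->
  word_map phi u x <> word_map phi v y.
Proof.
move=> H uv Xx Xy.
have [p [i [j [u' [v' [ij -> ->]]]]]] := incomparable_split uv.
rewrite !word_map_cat /= => e.
have {}e : phi i (word_map phi u' x) = phi j (word_map phi v' y).
  by apply: (word_map_inj H) e; apply/mem_set; apply: (cs_maps H);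
     apply: interior_subset; exact: (word_map_int H).
by apply: (cs_osc_disj H) e => //; exact: (word_map_int H).
Qed.

(** The ball about the image of [x1] under u lies in the image of the interior under u, which the
    image of [x1] under v avoids. *)
Lemma word_map_separated (R : realType) (d : nat) (I : eqType)
    (X V : set 'rV[R]_d) (phi : I -> 'rV[R]_d -> 'rV[R]_d) (s K : R) x1 :
  conformal_system X V phi s K -> X° x1 -> exists2 c, 0 < c &
  forall u v, incomparable u v ->
    c * opnorm ('d (word_map phi u) x1) <= `|word_map phi u x1 - word_map phi v x1|.
Proof.
move=> H Xx1; have [c c0 hc] := word_map_inner H Xx1.
exists c => // u v uv; rewrite leNgt; apply/negP => /hc[x Xx].
exact: (word_map_disjoint H uv Xx Xx1).
Qed.

(** * Packing and mass on trees *)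

(** Pigeonhole on a grid of mesh eta / 2: two points of one cell would be closer than eta, so the
    cell determines the point. The bound depends only on d, A and eta. *)
Lemma separated_size_bound (R : realType) (d : nat) (A eta : R) : 0 < eta ->
  exists N : nat, forall (T : eqType) (l : seq T) (q : T -> 'rV[R]_d), uniq l ->
    (forall t, t \in l -> `|q t| <= A) ->
    (forall t u, t \in l -> u \in l -> t <> u -> eta <= `|q t - q u|) ->
    (size l <= N)%N.
Proof.
move=> eta0; pose h := eta / 2.
have h0 : 0 < h by rewrite divr_gt0.
pose M := Num.truncn ((A + A) / h).
exists #|{ffun 'I_d -> 'I_M.+1}| => T l q ul lA lsep.
pose cell t i := Num.truncn ((q t ord0 i + A) / h).
pose key t : {ffun 'I_d -> 'I_M.+1} := [ffun i => inord (cell t i)].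
have cellP t i : t \in l ->
    (cell t i)%:R <= (q t ord0 i + A) / h < (cell t i).+1%:R.
  move=> tl; apply: truncn_itv; rewrite divr_ge0 ?(ltW h0)// -lerBlDr sub0r.
  have := le_trans (normr_coord_le (q t) i) (lA _ tl).
  by rewrite ler_norml => /andP[].
have cellM t i : t \in l -> (cell t i < M.+1)%N.
  move=> tl; rewrite ltnS; apply: le_truncn.
  rewrite ler_pM2r ?invr_gt0// lerD2r.
  by have := le_trans (normr_coord_le (q t) i) (lA _ tl); rewrite ler_norml => /andP[].
have inj : {in l &, injective key}.
  move=> t u tl ul' /ffunP e; apply/eqP/negPn/negP => /eqP /(lsep _ _ tl ul').
  apply/negP; rewrite -ltNge; apply: (@le_lt_trans _ _ h); last first.
    by rewrite /h ltr_pdivrMr// ltr_pMr// ltr1n.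
  apply: normr_le_coord => [|i]; first exact: ltW.
  have ce : cell t i = cell u i.
    have := e i; rewrite !ffunE => /(congr1 val); rewrite /= !inordK//; exact: cellM.
  move: (cellP t i tl) (cellP u i ul') => /andP[].
  rewrite !mxE ler_norml ce ler_pdivlMr// ltr_pdivrMr// => a1 a2 /andP[].
  rewrite ler_pdivlMr// ltr_pdivrMr// -natr1 mulrDl mul1r => b1 b2.
  rewrite -natr1 mulrDl mul1r in a2.
  by apply/andP; split; lra.
rewrite -(size_map key) -(card_uniqP _) ?map_inj_in_uniq//.
exact: max_card.
Qed.

(** A duplicate-free list in S of maximal length misses no element, since a missing one could be
    prepended. *)
Lemma bounded_enum (T : eqType) (S : set T) (N : nat) :
  (forall l, uniq l -> (forall t, t \in l -> S t) -> (size l <= N)%N) ->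
  exists2 l : seq T, (size l <= N)%N & forall t, t \in l <-> S t.
Proof.
move=> hN.
pose P n := `[< exists2 l : seq T, uniq l /\ size l = n & forall t, t \in l -> S t >].
have P0 : exists n, P n by exists 0%N; apply/asboolP; exists [::].
have PN n : P n -> (n <= N)%N.
  by move=> /asboolP[l [ul <-] lS]; exact: hN.
case: (ex_maxnP P0 PN) => n /asboolP[l [ul ln] lS] nmax.
exists l; first by rewrite hN.
move=> t; split; first exact: lS.
move=> St; apply/negPn/negP => tl.
have /nmax : P n.+1.
  apply/asboolP; exists (t :: l); first by rewrite /= tl ul ln.
  by move=> u; rewrite inE => /predU1P[->|/lS].
by rewrite ltnn.
Qed.

Lemma take_mkseq_le (T : Type) (f : nat -> T) m n : (m <= n)%N ->
  take m (mkseq f n) = mkseq f m.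
Proof. by move=> mn; rewrite /mkseq -map_take take_iota (minn_idPl mn). Qed.

Section MassTree.
Context {R : realType} {T : finType} (p : T -> R).
Context (p0 : forall t, 0 <= p t).
Context (p1 : \sum_t p t = 1).

(** The Bernoulli measure of the cylinder of w. Only masses of cylinders are used, so no measure on
    sequences is constructed. *)
Definition word_mass (w : seq T) : R := \prod_(t <- w) p t.

Lemma word_mass_ge0 w : 0 <= word_mass w.
Proof. exact: prodr_ge0. Qed.

Lemma word_mass_children w : \sum_t word_mass (rcons w t) = word_mass w.
Proof.
rewrite (eq_bigr (fun t => word_mass w * p t)).
  by rewrite -mulr_sumr p1 mulr1.
by move=> t _; rewrite /word_mass -cats1 big_cat big_seq1.
Qed.

(** A word extending w extends at most one child of w, and w itself extends none. *)
Lemma mass_below_children (l : seq (seq T)) (w : seq T) :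
  \sum_t \sum_(u <- l | prefix (rcons w t) u) word_mass u <=
  \sum_(u <- l | prefix w u) word_mass u.
Proof.
under eq_bigr do rewrite big_mkcond/=.
rewrite exchange_big [leRHS]big_mkcond/=; apply: ler_sum => u _.
have [/prefixP[v ->]|wu] := boolP (prefix w u); last first.
  rewrite big1// => t _; case: ifP => // /prefixP[v uE].
  by case/negP: wu; rewrite uE -cats1 -catA prefix_prefix.
case: v => [|t0 v].
  rewrite cats0 big1 ?word_mass_ge0// => t _; case: ifP => // /size_prefix.
  by rewrite size_rcons ltnn.
rewrite (bigD1 t0)//= big1 ?addr0; last first.
  move=> t tt0; case: ifP => // /prefixP[x].
  rewrite -cats1 -catA => /eqP; rewrite eqseq_cat// => /andP[_ /eqP[e]].
  by rewrite e eqxx in tt0.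
by case: ifP => // _; exact: word_mass_ge0.
Qed.

(* Words of total mass < 1 cannot block every infinite path: the mass of the
   words below a node stays smaller than the mass of the node along some child. *)
Lemma exists_avoiding_path (A : nat -> seq (seq T)) :
  (\sum_(0 <= k <oo) (\sum_(u <- A k) word_mass u)%:E < 1)%E ->
  exists w : nat -> T, forall m k, mkseq w m \notin A k.
Proof.
move=> A1.
pose G w : \bar R := (\sum_(0 <= k <oo) (\sum_(u <- A k | prefix w u) word_mass u)%:E)%E.
have g0 w k : 0 <= \sum_(u <- A k | prefix w u) word_mass u.
  by apply: sumr_ge0 => u _; exact: word_mass_ge0.
(* If every child failed, summing over the children would give mass w <= G w. The premise stands
   inside the existential so that choice yields a successor for every word. *)
have step w : exists t, (G w < (word_mass w)%:E)%E ->
    (G (rcons w t) < (word_mass (rcons w t))%:E)%E.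
  apply/not_existsP => h.
  have {}h t : (G w < (word_mass w)%:E)%E /\
      ((word_mass (rcons w t))%:E <= G (rcons w t))%E.
    have /not_implyP[h1 h2] := h t; split=> //.
    by rewrite leNgt; apply/negP.
  have [t0 _] : exists t : T, True.
    have : (0 < #|T|)%N.
      rewrite lt0n; apply/eqP => /eqP/pred0P T0.
      by move: p1; rewrite big_pred0 => [/esym/eqP|]; rewrite ?oner_eq0// => t; exact: T0.
    by move=> /card_gt0P[t _]; exists t.
  have := (h t0).1; apply/negP; rewrite -leNgt.
  rewrite -word_mass_children -sumEFin.
  apply: (@le_trans _ _ (\sum_t G (rcons w t))%E).
    by apply: lee_sum => t _; exact: (h t).2.
  rewrite /G -nneseries_sum; last by move=> k t _; rewrite lee_fin.
  apply: lee_nneseries => [k _ |k _]; last first.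
    by rewrite sumEFin lee_fin; exact: mass_below_children.
  by move=> _; apply: sume_ge0 => t _; rewrite lee_fin.

have /choice[nxt nxtP] := step.
pose st := fix st n : seq T := if n is m.+1 then rcons (st m) (nxt (st m)) else [::].
have stG n : (G (st n) < (word_mass (st n))%:E)%E.
  elim: n => [|n IH]; last exact: nxtP.
  rewrite /= /word_mass big_nil /G; apply: le_lt_trans A1.
  apply: lee_nneseries => [k _ _|k _]; rewrite lee_fin ?g0//.
  by rewrite [leLHS](eq_bigl xpredT)// => u; rewrite prefix0s.
exists (fun n => nxt (st n)) => m k.
have -> : mkseq (fun n => nxt (st n)) m = st m.
  by elim: m => [//|m IH]; rewrite mkseqS IH.
(* A word of the family on the path would itself contribute its full mass to G there. *)
apply/negP => mA; have := stG m; apply/negP; rewrite -leNgt.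
apply: (@le_trans _ _ (\sum_(u <- A k | prefix (st m) u) word_mass u)%:E).
  rewrite lee_fin (big_rem _ mA)/= prefix_refl lerDl.
  by apply: sumr_ge0 => u _; exact: word_mass_ge0.
rewrite /G (nneseriesD1 (n := k))//=; last by move=> j _; rewrite lee_fin.
by rewrite leeDl// nneseries_ge0// => j _ _; rewrite lee_fin.
Qed.

End MassTree.

(** * Scales and coverings *)

(** The images of a under the initial words cluster by compactness; each cylinder is closed and
    contains all later images, hence the cluster point. *)
Lemma exists_coding_point (R : realType) (d : nat) (I : Type)
    (X V : set 'rV[R]_d) (phi : I -> 'rV[R]_d -> 'rV[R]_d) (s K : R)
    (w : nat -> I) : conformal_system X V phi s K ->
  exists x, forall m, (word_map phi (mkseq w m) @` X) x.
Proof.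
move=> H; have [a /interior_subset Xa] := cs_int H.
pose z m := word_map phi (mkseq w m) a.
have zX m n : (m <= n)%N -> (word_map phi (mkseq w m) @` X) (z n).
  move=> mn; exists (word_map phi (drop m (mkseq w n)) a).
    exact: (word_map_X H).
  rewrite -[LHS]/((word_map phi (mkseq w m) \o _) a) -word_map_cat.
  by rewrite -(take_mkseq_le w mn) cat_take_drop.
have [|x [_ xz]] := cs_compact H (F := z @ \oo) _.
  exists 0%N => // n _ /=; rewrite /z.
  exact: (word_map_X H).
exists x => m.
have clm : closed (word_map phi (mkseq w m) @` X).
  apply: compact_closed; first exact: norm_hausdorff.
  apply: continuous_compact (cs_compact H).
  apply: continuous_in_subspaceT => y /set_mem Xy.
  apply: differentiable_continuous; apply: (word_map_diff H).
  exact: (cs_XV H).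
apply: clm => B /(xz _ _ _); apply.
by exists m => // n /= mn; exact: zX.
Qed.

Section MassDistribution.
Context {R : realType} {d : nat} {T : finType}.
Context {X V : set 'rV[R]_d} {psi : T -> 'rV[R]_d -> 'rV[R]_d} {s K : R}.
Context (H : conformal_system X V psi s K).

Local Notation D w x := (opnorm ('d (word_map psi w) x)).

(* The words of the cover are the first ones along an infinite path whose
   derivative at x1 drops below the scale rho. *)
Lemma cylinders_at_scale x1 : X° x1 -> exists N : nat,
  forall (rho : R) (U : set 'rV[R]_d), 0 < rho < 1 ->
    (forall x y, U x -> U y -> `|x - y| <= rho) ->
    exists l : seq (seq T), [/\ (size l <= N)%N,
      forall u, u \in l -> D u x1 <= rho &
      forall (w : nat -> T) x, U x -> (forall m, (word_map psi (mkseq w m) @` X) x) ->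
        exists m, mkseq w m \in l].
Proof.
move=> X1; have Xx1 := interior_subset X1; have Vx1 := cs_XV H Xx1.
have /andP[s0 s1] := cs_s01 H.
have K0 : 0 < K := lt_le_trans ltr01 (cs_K1 H).
have [C C0 hC] := word_map_diam H Vx1.
have [c c0 hc] := word_map_separated H X1.
(* Positive because the alphabet is finite. The last letter before stopping costs at most the factor
   [kap] = m0 / K. *)
pose m0 := \big[Num.min/1]_(t : T) D [:: t] x1.
have m00 : 0 < m0.
  by apply: lt_bigmin => // t _; exact: (opnorm_word_gt0 H).
have hm0 t : m0 <= D [:: t] x1 by exact: bigmin_le_cond.
pose kap := m0 / K.
have kap0 : 0 < kap by rewrite divr_gt0.
(* After centring in U and rescaling by 1 / rho, the images of [x1] under the stopping words meeting
   U have norm at most 1 + C and are c * kap apart. *)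
have [N hN] := @separated_size_bound R d (1 + C) (c * kap) (mulr_gt0 c0 kap0).
exists N => rho U /andP[r0 r1] Ud.
pose S := [set u : seq T | [/\ D u x1 <= rho,
  forall m, (m < size u)%N -> rho < D (take m u) x1 &
  exists2 x, U x & (word_map psi u @` X) x]].
(* A proper prefix of a stopping word still has derivative above rho, so it is not a stopping
   word. *)
have S_incomp u v : S u -> S v -> u <> v -> incomparable u v.
  move=> Su Sv uv; apply/andP; split; apply/negP.
    case: Su Sv => u1 u2 _ [v1 v2 _] /prefixP[[|t z] vE].
      by apply: uv; rewrite vE cats0.
    have := v2 (size u); rewrite vE size_cat /= take_size_cat// addnS ltnS leq_addr.
    by move=> /(_ isT); rewrite ltNge u1.
  case: Sv Su => u1 u2 _ [v1 v2 _] /prefixP[[|t z] vE].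
    by apply: uv; rewrite vE cats0.
  have := v2 (size v); rewrite vE size_cat /= take_size_cat// addnS ltnS leq_addr.
  by move=> /(_ isT); rewrite ltNge u1.
have S_low u : S u -> kap * rho <= D u x1.
  (* The empty word has derivative 1 > rho, so a stopping word has a last letter to remove. *)
  case/lastP: u => [|u t] [u1 u2 _].
    by move: u1; rewrite (opnorm_nil H) leNgt r1.
  have := u2 (size u); rewrite size_rcons ltnSn -cats1 take_size_cat// => /(_ isT) hu.
  rewrite (opnorm_cat H u [:: t] Vx1).
  have Vtx := word_map_V H [:: t] Vx1.
  have h1 : D u x1 <= K * D u (word_map psi [:: t] x1) by exact: (cs_distortion H).
  have h2 : rho / K <= D u (word_map psi [:: t] x1).
    by rewrite ler_pdivrMr// mulrC; exact: le_trans (ltW hu) h1.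
  rewrite (_ : kap * rho = rho / K * m0); last by rewrite /kap; ring.
  exact: (ler_pM (ltW (divr_gt0 r0 K0)) (ltW m00) h2 (hm0 t)).
have [l lN lS] : exists2 l : seq (seq T), (size l <= N)%N & forall u, u \in l <-> S u.
  apply: bounded_enum => l ul lS.
  case: (pselect (exists u0, U u0)) => [[u0 Uu0]|nU]; last first.
    case: l lS {ul} => [//|u l] /(_ u (mem_head _ _))[_ _ [x Ux _]].
    by exfalso; apply: nU; exists x.
  apply: (hN _ l (fun u => rho^-1 *: (word_map psi u x1 - u0))) => //.
    move=> u /lS[u1 _ [x Ux [y Xy yx]]].
    rewrite normrZ gtr0_norm ?invr_gt0// ler_pdivrMl//.
    rewrite mulrDr mulr1 -(subrKA x) [leRHS]addrC.
    apply: le_trans (ler_normD _ _) _; apply: lerD; last exact: Ud.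
    by rewrite -yx; apply: le_trans (hC _ _ _ Xx1 Xy) _; rewrite mulrC ler_pM2r.
  move=> u v /lS Su /lS Sv uv.
  rewrite -scalerBr opprB addrA subrK normrZ gtr0_norm ?invr_gt0// ler_pdivlMl//.
  apply: le_trans (hc u v (S_incomp _ _ Su Sv uv)).
  by rewrite mulrC -mulrA ler_pM2l//; exact: S_low.
exists l; split => //; first by move=> u /lS[].
move=> w x Ux wx.
have ex : exists m, D (mkseq w m) x1 <= rho.
  have [m hm] : exists m : nat, s ^+ m <= rho.
    have : s ^+ n @[n --> \oo] --> 0 by apply: cvg_expr; rewrite gtr0_norm.
    move=> /cvgrPdist_le/(_ _ r0)[m _ /(_ m (leqnn m))] /=.
    have sm0 : 0 <= s ^+ m by rewrite exprn_ge0// ltW.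
    by rewrite sub0r normrN ger0_norm// => ?; exists m.
  exists m; apply: le_trans hm.
  by have := opnorm_word_le H (mkseq w m) Xx1; rewrite size_mkseq.
case: (ex_minnP ex) => m mrho mmin; exists m; apply/lS; split=> //; last by exists x.
move=> j; rewrite size_mkseq => jm; rewrite take_mkseq_le 1?ltnW// ltNge.
by apply/negP => /mmin; rewrite leqNgt jm.
Qed.

End MassDistribution.

Lemma ediam_ge0 (R : realType) (d : nat) (U : set 'rV[R]_d) :
  U !=set0 -> (0 <= ediam U)%E.
Proof.
move=> [x Ux]; apply: ereal_sup_ubound; exists (x, x) => //=.
by rewrite subrr enorm0.
Qed.

Lemma le_ediam (R : realType) (d : nat) (U : set 'rV[R]_d) x y :
  U x -> U y -> ((enorm (x - y))%:E <= ediam U)%E.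
Proof. by move=> Ux Uy; apply: ereal_sup_ubound; exists (x, y). Qed.

Lemma hausdorff_weight_ge0 (R : realType) (d : nat) (delta : R) (U : set 'rV[R]_d) :
  (0 <= hausdorff_weight delta U)%E.
Proof. by rewrite /hausdorff_weight; case: ifP => // _; exact: poweR_ge0. Qed.

(* Sets of diameter 0 have weight 0 when delta > 0, so they need a positive
   scale with small power; hence the error term. *)
Lemma exists_scale (R : realType) (d : nat) (delta e : R) (U : set 'rV[R]_d) :
  0 <= delta -> 0 < e -> U !=set0 -> (ediam U <= (2^-1)%:E)%E ->
  exists rho : R, [/\ 0 < rho < 1, forall x y, U x -> U y -> `|x - y| <= rho &
    ((rho `^ delta)%:E <= hausdorff_weight delta U + e%:E)%E].
Proof.
move=> d0 e0 U0 hU.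
have h1 : 2^-1 < 1 :> R by rewrite invf_lt1// ltr1n.
have [a aE] : exists a, ediam U = a%:E.
  have := ediam_ge0 U0; move: hU.
  by case: (ediam U) => [a _ _|//|//]; exists a.
have a0 : 0 <= a by rewrite -lee_fin -aE; exact: ediam_ge0.
have a2 : a <= 2^-1 by rewrite -lee_fin -aE.
have ha x y : U x -> U y -> `|x - y| <= a.
  move=> Ux Uy; apply: le_trans (normr_le_enorm _) _.
  by rewrite -lee_fin -aE; exact: le_ediam.
have -> : hausdorff_weight delta U = (a `^ delta)%:E.
  rewrite /hausdorff_weight aE poweR_EFin; case: eqP => // U0'.
  by move: U0; rewrite U0' => -[].
move: a0; rewrite le_eqVlt => /predU1P[a0|a0]; last first.
  exists a; rewrite a0 (le_lt_trans a2 h1); split => //.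
  by rewrite -EFinD lee_fin lerDl ltW.
move: d0; rewrite le_eqVlt => /predU1P[d0|d0].
  exists (2^-1); rewrite h1 invr_gt0 ltr0n; split => // [x y Ux Uy|].
    exact: le_trans (ha _ _ Ux Uy) a2.
  by rewrite -d0 !powRr0 -EFinD lee_fin lerDl ltW.
exists (Num.min 2^-1 (e `^ delta^-1)); split.
- by rewrite lt_min invr_gt0 ltr0n powR_gt0// gt_min h1.
- move=> x y Ux Uy; apply: le_trans (ha _ _ Ux Uy) _.
  by rewrite -a0 le_min invr_ge0 ler0n powR_ge0.
- rewrite -EFinD lee_fin; apply: (@le_trans _ _ e); last by rewrite lerDr powR_ge0.
  apply: (@le_trans _ _ ((e `^ delta^-1) `^ delta)).
    have h : Num.min 2^-1 (e `^ delta^-1) <= e `^ delta^-1 by rewrite ge_min lexx orbT.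
    have h0 : 0 <= Num.min 2^-1 (e `^ delta^-1) by rewrite le_min invr_ge0 ler0n powR_ge0.
    by apply: ge0_ler_powR h; rewrite ?nnegrE ?powR_ge0// ltW.
  by rewrite -powRrM mulVf ?gt_eqF// powRr1// ltW.
Qed.

(** * The mass distribution principle for finite systems *)

Section PositiveMeasure.
Context {R : realType} {d : nat} {T : finType}.
Context {X V : set 'rV[R]_d} {psi : T -> 'rV[R]_d -> 'rV[R]_d} {s K : R}.
Context (H : conformal_system X V psi s K).
Context (c : T -> R) (delta : R).
Context (d0 : 0 <= delta).
Context (c0 : forall t, 0 <= c t).
Context (cD : forall t x, X x -> c t <= opnorm ('d (psi t) x)).
Context (c1 : 1 <= \sum_t c t `^ delta).

Local Notation D w x := (opnorm ('d (word_map psi w) x)).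

Let p t := c t `^ delta / \sum_t c t `^ delta.

Let Z0 : 0 < \sum_t c t `^ delta. Proof. exact: lt_le_trans c1. Qed.

Let p0 t : 0 <= p t.
Proof. by rewrite divr_ge0 ?powR_ge0// ltW. Qed.

Let p1 : \sum_t p t = 1.
Proof. by rewrite -mulr_suml divff// gt_eqF. Qed.

(** The normalising sum is at least 1, so p t is at most c t to the power delta; the chain rule
    multiplies the letter bounds. *)
Lemma word_mass_le u x : X x -> word_mass p u <= D u x `^ delta.
Proof.
move=> Xx; have Vx := cs_XV H Xx; elim: u => [|t u IH].
  by rewrite /word_mass big_nil (opnorm_nil H) powR1.
rewrite /word_mass big_cons -cat1s (opnorm_cat H [:: t] u Vx).
have Xux := word_map_X H u Xx.
have D0 : 0 <= D [:: t] (word_map psi u x).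
  by apply/ltW/(opnorm_word_gt0 H); exact: cs_XV H _ Xux.
have Du0 : 0 <= D u x by exact/ltW/(opnorm_word_gt0 H).
rewrite powRM//; apply: (ler_pM (p0 t) (word_mass_ge0 p0 u) _ IH).
apply: (@le_trans _ _ (c t `^ delta)).
  by rewrite /p ler_pdivrMr// ler_peMr ?powR_ge0.
have cDt : c t <= D [:: t] (word_map psi u x) := cD t Xux.
exact: (ge0_ler_powR d0 (c0 t) D0 cDt).
Qed.

(** A cover of small total weight gives lists of cylinders of total mass below 1. A path avoiding
    them all codes a point of the limit set that no set of the cover contains. *)
Lemma hausdorff_measure_limit_set_neq0 : hausdorff_measure delta (limit_set X psi) <> 0%E.
Proof.
move=> HM0.
have [x1 X1] := cs_int H; have Xx1 := interior_subset X1.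
have [N hN] := cylinders_at_scale H X1.
(* The cover weighs less than e and the error terms add up to e; N + 1 times their sum is at most 1
   / 2 < 1. *)
pose e : R := ((4 * N.+1)%:R)^-1.
have e0 : 0 < e by rewrite invr_gt0 ltr0n.
(* The mesh 1 / 2 is the diameter bound required by [exists_scale]. *)
have : (hausdorff_premeasure delta 2^-1 (limit_set X psi) < e%:E)%E.
  apply: (@le_lt_trans _ _ 0%E); last by rewrite lte_fin.
  by rewrite -HM0; apply: ereal_sup_ubound; exists 2^-1 => //=; rewrite invr_gt0 ltr0n.
move=> /ereal_inf_lt[_ [U [cU dU] <-] We].
have ek k : 0 < e / (2 ^ k.+1)%:R by rewrite divr_gt0// ltr0n expn_gt0.
have step k : exists l : seq (seq T),
    ((\sum_(u <- l) word_mass p u)%:E <= N.+1%:R%:E *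
      (hausdorff_weight delta (U k) + (e / (2 ^ k.+1)%:R)%:E))%E /\
    forall (w : nat -> T) x, U k x -> (forall m, (word_map psi (mkseq w m) @` X) x) ->
        exists m, mkseq w m \in l.
  case: (pselect (U k !=set0)) => [Uk|Uk]; last first.
    exists [::]; split; last by move=> w x Ux; exfalso; apply: Uk; exists x.
    rewrite big_nil mule_ge0 ?lee_fin// adde_ge0 ?hausdorff_weight_ge0//.
    by rewrite lee_fin ltW.
  have [rho [rho01 rU rW]] := exists_scale d0 (ek k) Uk (dU k).
  have [l [lN lr lP]] := hN rho (U k) rho01 rU.
  exists l; split=> //.
  apply: (@le_trans _ _ (N.+1%:R * rho `^ delta)%:E); last first.
    by rewrite EFinM lee_wpmul2l// lee_fin.
  rewrite lee_fin; apply: (@le_trans _ _ (\sum_(u <- l) rho `^ delta)).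
    rewrite big_seq [leRHS]big_seq; apply: ler_sum => u /lr ur.
    apply: le_trans (word_mass_le u Xx1) _.
    have /andP[r0 _] := rho01.
    apply: ge0_ler_powR; rewrite ?nnegrE ?(ltW r0)//.
    by apply/ltW/(opnorm_word_gt0 H); exact: cs_XV H _ Xx1.
  rewrite big_const_seq count_predT iter_addr addr0 -[leLHS]mulr_natl.
  by rewrite ler_wpM2r ?powR_ge0// ler_nat ltnW.
have /choice[A hA] := step.
have [|w hw] := exists_avoiding_path p0 p1 (A := A).
  apply: (@le_lt_trans _ _ (\sum_(0 <= k <oo) (N.+1%:R%:E *
      (hausdorff_weight delta (U k) + (e / (2 ^ k.+1)%:R)%:E)))%E).
    apply: lee_nneseries => [k _ _|k _]; last exact: (hA k).1.
    by rewrite lee_fin sumr_ge0// => u _; exact: word_mass_ge0.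
  rewrite nneseriesZl; last first.
    move=> k _; rewrite adde_ge0 ?hausdorff_weight_ge0//.
    by rewrite lee_fin ltW.
  apply: (@le_lt_trans _ _ (N.+1%:R%:E * (e%:E + e%:E))%E).
    rewrite lee_wpmul2l ?lee_fin//.
    apply: le_trans (epsilon_trick _ _ (ltW e0)) _.
      by move=> k; exact: hausdorff_weight_ge0.
    by rewrite leeD2r// ltW.
  rewrite -EFinD -EFinM lte_fin (_ : _ * _ = 2^-1) ?invf_lt1 ?ltr1n//.
  have : N.+1%:R != 0 :> R by rewrite pnatr_eq0.
  by rewrite /e natrM; move: (N.+1%:R) => M M0; field.
have [x hx] := @exists_coding_point _ _ _ _ _ _ _ _ w H.
have [k _ Ukx] : (\bigcup_k U k) x by apply: cU; exists w => // m _; exact: hx.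
have [m] := (hA k).2 w x Ukx hx.
by apply/negP; exact: hw.
Qed.

End PositiveMeasure.

(** * Upper bound *)

(** The bound is checked on finite partial sums, so c may be infinite, as a pressure sum can be. *)
Lemma esumZ_le (R : realType) (T : choiceType) (S : set T) (c : \bar R) (a : T -> \bar R) :
  (0 <= c)%E -> (forall i, (0 <= a i)%E) ->
  (\esum_(i in S) (c * a i) <= c * \esum_(i in S) a i)%E.
Proof.
move=> c0 a0; apply: ge_ereal_sup => _ [A [fA AS] <-].
rewrite -ge0_mule_fsumr//; apply: lee_wpmul2l => //.
by apply: ereal_sup_ubound; exists A.
Qed.

Lemma ediam_le (R : realType) (d : nat) (U : set 'rV[R]_d) (b : \bar R) :
  (forall x y, U x -> U y -> ((enorm (x - y))%:E <= b)%E) -> (ediam U <= b)%E.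
Proof. by move=> h; apply: ge_ereal_sup => _ [[x y] [/= Ux Uy] <-]; exact: h. Qed.

Lemma hausdorff_weight_le (R : realType) (d : nat) (delta b : R) (U : set 'rV[R]_d) :
  0 <= delta -> 0 <= b -> (ediam U <= b%:E)%E ->
  (hausdorff_weight delta U <= (b `^ delta)%:E)%E.
Proof.
move=> d0 b0 Ub; rewrite /hausdorff_weight; case: eqP => [_|/eqP/set0P U0].
  by rewrite lee_fin powR_ge0.
rewrite -poweR_EFin; apply: gt0_ler_poweR => //.
- by rewrite in_itv/= ediam_ge0//= leey.
- by rewrite in_itv/= lee_fin b0 leey.
Qed.

Lemma hausdorff_premeasure_ge0 (R : realType) (d : nat) (delta r : R) (A : set 'rV[R]_d) :
  (0 <= hausdorff_premeasure delta r A)%E.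
Proof.
apply: le_ereal_inf_tmp => _ [U _ <-]; apply: nneseries_ge0 => k _ _.
exact: hausdorff_weight_ge0.
Qed.

Lemma hausdorff_measure_ge0 (R : realType) (d : nat) (delta : R) (A : set 'rV[R]_d) :
  (0 <= hausdorff_measure delta A)%E.
Proof.
apply: (le_trans (hausdorff_premeasure_ge0 delta 1 A)).
by apply: ereal_sup_ubound; exists 1 => //=.
Qed.

Lemma hausdorff_measure_subset (R : realType) (d : nat) (delta : R) (A B : set 'rV[R]_d) :
  A `<=` B -> (hausdorff_measure delta A <= hausdorff_measure delta B)%E.
Proof.
move=> AB; apply: ge_ereal_sup => _ [r r0 <-].
apply: (@le_trans _ _ (hausdorff_premeasure delta r B)).
  apply: ereal_inf_le_tmp => _ [U [BU Ur] <-]; exists U => //; split=> //.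
  exact: subset_trans BU.
by apply: ereal_sup_ubound; exists r.
Qed.

Lemma hausdorff_dim_subset (R : realType) (d : nat) (A B : set 'rV[R]_d) :
  A `<=` B -> (hausdorff_dim A <= hausdorff_dim B)%E.
Proof.
move=> AB; apply: ereal_inf_le_tmp => _ [delta [d0 hB] <-]; exists delta => //.
split=> //; apply/le_anti; rewrite hausdorff_measure_ge0 andbT -hB.
exact: hausdorff_measure_subset.
Qed.

Lemma hausdorff_dim_ge0 (R : realType) (d : nat) (A : set 'rV[R]_d) :
  (0 <= hausdorff_dim A)%E.
Proof. by apply: le_ereal_inf_tmp => _ [delta [d0 _] <-]; rewrite lee_fin. Qed.

(** The summand of [pressure_sum], for words of any length so that concatenations can be treated. *)
Definition word_weight (R : realType) (d : nat) (I : Type) (X : set 'rV[R]_d)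
    (phi : I -> 'rV[R]_d -> 'rV[R]_d) (delta : R) (w : seq I) : \bar R :=
  ereal_sup [set (opnorm ('d (word_map phi w) x) `^ delta)%:E | x in X].

Section UpperBound.
Context {R : realType} {d : nat} {I : countType}.
Context {X V : set 'rV[R]_d} {phi : I -> 'rV[R]_d -> 'rV[R]_d} {s K : R}.
Context (H : conformal_system X V phi s K).

Local Notation D w x := (opnorm ('d (word_map phi w) x)).

Lemma word_weight_ge x delta w : X x -> ((D w x `^ delta)%:E <= word_weight X phi delta w)%E.
Proof. by move=> Xx; apply: ereal_sup_ubound; exists x. Qed.

Lemma word_weight_ge0 delta w : (0 <= word_weight X phi delta w)%E.
Proof.
have [x /interior_subset Xx] := cs_int H.
by apply: le_trans (word_weight_ge delta w Xx); rewrite lee_fin powR_ge0.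
Qed.

Lemma pressure_sum_ge0 delta n : (0 <= pressure_sum X phi delta n)%E.
Proof. by apply: esum_ge0 => w _; exact: word_weight_ge0. Qed.

Lemma cylinder_ediam_le : exists2 C, 0 < C &
  forall w x, X x -> (ediam (word_map phi w @` X) <= (C * D w x)%:E)%E.
Proof.
have [x0 /interior_subset Xx0] := cs_int H; have Vx0 := cs_XV H Xx0.
have K0 : 0 < K := lt_le_trans ltr01 (cs_K1 H).
have [C C0 hC] := word_map_diam H Vx0.
exists (d%:R * C * K); first by rewrite !mulr_gt0// ltr0n (cs_dim H).
move=> w x Xx; have Vx := cs_XV H Xx.
apply: ediam_le => _ _ [y Xy <-] [z Xz <-]; rewrite lee_fin.
apply: le_trans (enorm_le_normr _) _.
rewrite -!mulrA ler_wpM2l//; apply: le_trans (hC w y z Xy Xz) _.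
by rewrite ler_wpM2l// ?(ltW C0)//; exact: (cs_distortion H).
Qed.

Lemma cylinders_small r : 0 < r -> exists n0 : nat, forall n (w : seq I), (n0 <= n)%N ->
  size w = n -> (ediam (word_map phi w @` X) <= r%:E)%E.
Proof.
move=> r0; have [x0 /interior_subset Xx0] := cs_int H; have Vx0 := cs_XV H Xx0.
have [C C0 hC] := cylinder_ediam_le.
have /andP[s0 s1] := cs_s01 H.
have : s ^+ n @[n --> \oo] --> 0 by apply: cvg_expr; rewrite gtr0_norm.
move=> /cvgrPdist_le/(_ (r / C) (divr_gt0 r0 C0))[n0 _ hn]; exists n0 => n w n0n wn.
apply: le_trans (hC w x0 Xx0) _; rewrite lee_fin mulrC -ler_pdivlMr//.
apply: le_trans (opnorm_word_le H w Xx0) _; rewrite wn.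
have := hn n n0n => /=; rewrite sub0r normrN ger0_norm//.
by rewrite exprn_ge0// ltW.
Qed.

Lemma limit_set_cover n : (1 <= n)%N ->
  limit_set X phi `<=` \bigcup_(w in [set: n.-tuple I]) (word_map phi w @` X).
Proof.
move=> n1 x [w _ /(_ n n1) xw].
by exists (Tuple (introT eqP (size_mkseq w n))).
Qed.

Lemma hausdorff_premeasure_le_sum delta r n C : 0 <= delta -> (1 <= n)%N -> 0 < C ->
  (forall w x, X x -> (ediam (word_map phi w @` X) <= (C * D w x)%:E)%E) ->
  (forall w : n.-tuple I, (ediam (word_map phi w @` X) <= r%:E)%E) ->
  (hausdorff_premeasure delta r (limit_set X phi) <=
    (C `^ delta)%:E * pressure_sum X phi delta n)%E.
Proof.
move=> d0 n1 C0 hC hr.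
(* Words are enumerated by their codes; a number coding no word gets the empty set, of weight 0 even
   for delta = 0. *)
pose U k : set 'rV[R]_d :=
  if @pickle_inv (n.-tuple I) k is Some w then word_map phi w @` X else set0.
apply: (@le_trans _ _ (\sum_(0 <= k <oo) hausdorff_weight delta (U k))%E).
  apply: ereal_inf_lbound; exists U => //; split.
    apply: subset_trans (limit_set_cover n1) _ => x [w _ xw].
    by exists (pickle w) => //; rewrite /U pickleK_inv.
  move=> k; rewrite /U; case: pickle_inv => [w|]; first exact: hr.
  by apply: ediam_le.
have [x0 /interior_subset Xx0] := cs_int H; have Vx0 := cs_XV H Xx0.
rewrite nneseries_esumT; last by move=> k; exact: hausdorff_weight_ge0.
rewrite (_ : \esum_(k in setT) _ =
    \esum_(k in [set pickle w | w in [set: n.-tuple I]]) hausdorff_weight delta (U k)); last first.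
  rewrite [RHS]esum_mkcond; apply: eq_esum => k _; case: ifPn => // /negP kn.
  rewrite /U; case E : (@pickle_inv (n.-tuple I) k) => [w|].
    exfalso; apply: kn; apply/mem_set; exists w => //.
    by have := @pickle_invK (n.-tuple I) k; rewrite E.
  by rewrite /hausdorff_weight eqxx.
rewrite esum_image; last first.
  by move=> u v _ _ /(congr1 (@pickle_inv (n.-tuple I))); rewrite !pickleK_inv => -[].
apply: le_trans (esumZ_le _ _ _); last 2 first.
- by rewrite lee_fin powR_ge0.
- by move=> w; exact: word_weight_ge0.
apply: le_esum => w _; rewrite /U pickleK_inv.
have CD0 : 0 <= D w x0 by apply/ltW/(opnorm_word_gt0 H).
apply: le_trans (hausdorff_weight_le d0 _ (hC w x0 Xx0)) _.
  by rewrite mulr_ge0// ltW.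
rewrite powRM ?(ltW C0)// EFinM lee_wpmul2l ?lee_fin ?powR_ge0//.
exact: word_weight_ge.
Qed.

Lemma hausdorff_measure_limit_set_eq0 delta : 0 <= delta ->
  (forall (e : R) (n0 : nat), 0 < e ->
    exists2 n, (n0 <= n)%N & (pressure_sum X phi delta n < e%:E)%E) ->
  hausdorff_measure delta (limit_set X phi) = 0%E.
Proof.
move=> d0 hZ; apply/le_anti; rewrite hausdorff_measure_ge0 andbT.
apply: ge_ereal_sup => _ [r /= r0 <-].
apply/lee_addgt0Pr => e e0; rewrite add0e.
have [C C0 hC] := cylinder_ediam_le.
have [n0 hn0] := cylinders_small r0.
have Cd : 0 < C `^ delta by exact: powR_gt0.
have [n nn Zn] := hZ (e / C `^ delta) (maxn 1 n0) (divr_gt0 e0 Cd).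
have [n1 n0n] : (1 <= n)%N /\ (n0 <= n)%N by move: nn; rewrite geq_max => /andP.
apply: le_trans (hausdorff_premeasure_le_sum d0 n1 C0 hC _) _.
  by move=> w; apply: (hn0 n) => //; rewrite size_tuple.
apply: (@le_trans _ _ ((C `^ delta)%:E * (e / C `^ delta)%:E)%E).
  by rewrite lee_wpmul2l ?lee_fin ?(ltW Cd)// ltW.
by rewrite -EFinM lee_fin mulrCA divff ?mulr1// gt_eqF.
Qed.

End UpperBound.

(** * Pressure *)

(** The limit is the infimum of a n / n, finite because of B: writing n as a multiple of a nearly
    optimal m plus a bounded remainder compares a n / n with a m / m. *)
Lemma fekete (R : realType) (a : nat -> R) (B : R) :
  (forall m n, (1 <= m)%N -> (1 <= n)%N -> a (m + n)%N <= a m + a n) ->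
  (forall n, (1 <= n)%N -> B * n%:R <= a n) ->
  cvgn (fun n => n%:R^-1 * a n).
Proof.
move=> aD aB.
pose E := [set n%:R^-1 * a n | n in [set n : nat | (1 <= n)%N]].
have E0 : E !=set0 by exists (1%:R^-1 * a 1%N), 1%N.
have EB : has_lbound E.
  exists B => _ [n /= n1 <-]; rewrite mulrC ler_pdivlMr ?ltr0n//; exact: aB.
have aM m q : (1 <= m)%N -> forall r, (1 <= r)%N -> a (q * m + r)%N <= q%:R * a m + a r.
  move=> m1; elim: q => [|q IH] r r1; first by rewrite mul0n mul0r add0r.
  rewrite mulSn -addnA -natr1 mulrDl mul1r.
  apply: le_trans (aD _ _ m1 _) _; first by rewrite addn_gt0 r1 orbT.
  by have := IH r r1; lra.
apply/cvg_ex; exists (inf E); apply/cvgrPdist_lt => e e0.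
have e2 : 0 < e / 2 by rewrite divr_gt0.
have [_ [m /= m1 <-] hm] := inf_adherent e2 (conj E0 EB).
set L := inf E in hm *.
have am : a m <= m%:R * (L + e / 2).
  by rewrite -ler_pdivrMl ?ltr0n// ltW.
(* Bounds, independently of n, both the value of a at the remainder and the remainder times L + e /
   2. *)
pose B1 := \sum_(r < m) `|a r.+1| + m%:R * `|L + e / 2|.
have B10 : 0 <= B1 by rewrite addr_ge0 ?mulr_ge0 ?sumr_ge0.
near=> n.
have n1 : (1 <= n)%N by near: n; exists 1%N.
have n0 : 0 < n%:R :> R by rewrite ltr0n.
have nB : B1 / (e / 2) < n%:R.
  near: n; exact: nbhs_infty_gtr.
have Ln : L <= n%:R^-1 * a n by apply: ge_inf => //; exists n.
suff un : n%:R^-1 * a n < L + e by rewrite ltr_norml; apply/andP; split; lra.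
rewrite ltr_pdivrMl//.
(* Dividing n - 1 puts the remainder between 1 and m, where subadditivity is available. *)
have nE : n = (n.-1 %/ m * m + (n.-1 %% m).+1)%N.
  by rewrite addnS -divn_eq prednK.
set q := (n.-1 %/ m)%N in nE; set r := (n.-1 %% m)%N in nE.
have rm : (r < m)%N by rewrite ltn_mod.
have ar : `|a r.+1| <= \sum_(r < m) `|a r.+1|.
  by rewrite (bigD1 (Ordinal rm))//= lerDl sumr_ge0.
have an : a n <= q%:R * a m + a r.+1 by rewrite [in leLHS]nE; exact: aM.
have nR : n%:R = q%:R * m%:R + r.+1%:R :> R by rewrite [in LHS]nE natrD natrM.
have rmR : r.+1%:R <= m%:R :> R by rewrite ler_nat.
have r0 : 0 <= r.+1%:R :> R by [].
have qam : q%:R * a m <= q%:R * (m%:R * (L + e / 2)) by rewrite ler_wpM2l.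
have h1 : - (r.+1%:R * (L + e / 2)) <= m%:R * `|L + e / 2|.
  rewrite -mulrN; apply: (@le_trans _ _ (r.+1%:R * `|L + e / 2|)).
    by rewrite ler_wpM2l// -normrN ler_norm.
  by rewrite ler_wpM2r.
have h2 : a r.+1 <= \sum_(r < m) `|a r.+1| by exact: le_trans (ler_norm _) ar.
have h3 : B1 < n%:R * (e / 2) by rewrite -ltr_pdivrMr.
have h4 : q%:R * (m%:R * (L + e / 2)) = n%:R * (L + e / 2) - r.+1%:R * (L + e / 2).
  by rewrite nR; ring.
rewrite /B1 in h3.
rewrite (_ : n%:R * (L + e) = n%:R * (L + e / 2) + n%:R * (e / 2)); last by field.
lra.
Unshelve. all: by end_near. Qed.

Section Pressure.
Context {R : realType} {d : nat} {I : countType}.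
Context {X V : set 'rV[R]_d} {phi : I -> 'rV[R]_d -> 'rV[R]_d} {s K : R}.
Context (H : conformal_system X V phi s K).

Local Notation D w x := (opnorm ('d (word_map phi w) x)).
Local Notation Z delta n := (pressure_sum X phi delta n).

(* A divergent limn has the junk value 0, so a negative pressure is a genuine
   limit. *)
Lemma pressure_lt0_sum_small delta : (pressure X phi delta < 0)%E ->
  forall (e : R) (n0 : nat), 0 < e -> exists2 n, (n0 <= n)%N & (Z delta n < e%:E)%E.
Proof.
move=> P0 e n0 e0.
pose u n := ((n%:R^-1)%:E * lne (Z delta n))%E.
have cu : cvgn u.
  apply: contrapT => /dvgP du; move: P0; rewrite /pressure -/u du.
  by rewrite /point/= ltxx.
have [c c0 Pc] : exists2 c : R, c < 0 & (limn u < c%:E)%E.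
  move: P0; rewrite /pressure -/u; case: (limn u) => [l|//|_].
    by rewrite lte_fin => l0; exists (l / 2); rewrite ?lte_fin; lra.
  by exists (-1) => //; rewrite ?ltNyr// oppr_lt0.
have : \forall n \near \oo, (u n < c%:E)%E.
  exact: (cu [set y | (y < c%:E)%E] (open_ereal_lt' Pc)).
move=> un.
have : \forall n \near \oo, [/\ (n0 <= n)%N, (1 <= n)%N, (u n < c%:E)%E &
    ln e / c <= n%:R].
  near=> n; split; near: n; [by exists n0|by exists 1%N|by []|exact: nbhs_infty_ger].
move=> [n _ /(_ n (leqnn n))] [n0n n1 unc hn]; exists n => //.
rewrite ltNge; apply/negP => eZ.
have ln_le : ((ln e)%:E <= lne (Z delta n))%E.
  rewrite -lne_EFin// lee_lne ?in_itv//= ?lee_fin ?(ltW e0) ?leey//.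
  by rewrite (pressure_sum_ge0 H).
have n0' : 0 < n%:R :> R by rewrite ltr0n.
have : ((n%:R^-1 * ln e)%:E <= u n)%E.
  by rewrite EFinM lee_wpmul2l// lee_fin invr_ge0.
move=> /le_lt_trans/(_ unc); rewrite lte_fin ltr_pdivrMl//.
by apply/negP; rewrite -leNgt -ler_ndivrMr.
Unshelve. all: by end_near. Qed.

Lemma word_weight_cat delta u v : 0 <= delta ->
  (word_weight X phi delta (u ++ v) <= word_weight X phi delta u * word_weight X phi delta v)%E.
Proof.
move=> d0; apply: ge_ereal_sup => _ [x Xx <-].
have Vx := cs_XV H Xx; have Xvx := word_map_X H v Xx; have Vvx := cs_XV H Xvx.
rewrite (opnorm_cat H u v Vx) powRM; last 2 first.
- exact/ltW/(opnorm_word_gt0 H).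
- exact/ltW/(opnorm_word_gt0 H).
rewrite EFinM; apply: lee_pmul; rewrite ?lee_fin ?powR_ge0//.
- exact: word_weight_ge.
- exact: word_weight_ge.
Qed.

Lemma pressure_sumD_le delta m n : 0 <= delta ->
  (Z delta (m + n) <= Z delta m * Z delta n)%E.
Proof.
move=> d0; rewrite /pressure_sum.
pose cat2 (k : m.-tuple I * n.-tuple I) := cat_tuple k.1 k.2.
have bij : set_bij ([set: m.-tuple I] `*`` fun=> [set: n.-tuple I])
    [set: (m + n).-tuple I] cat2.
  split=> //.
    move=> [u v] [u' v'] _ _ /(congr1 val)/= /eqP.
    rewrite eqseq_cat ?size_tuple// => /andP[/eqP/val_inj -> /eqP/val_inj ->].
    by [].
  move=> w _.
  have hm : size (take m w) == m by rewrite size_takel// size_tuple leq_addr.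
  have hn : size (drop m w) == n by rewrite size_drop size_tuple addKn.
  exists (Tuple hm, Tuple hn) => //.
  by apply: val_inj; rewrite /= cat_take_drop.
rewrite (reindex_esum _ _ _ _ bij).
apply: (@le_trans _ _ (\esum_(k in [set: m.-tuple I] `*`` fun=> [set: n.-tuple I])
    (word_weight X phi delta k.1 * word_weight X phi delta k.2))%E).
  by apply: le_esum => -[u v] _; exact: word_weight_cat.
rewrite -(esum_esum (a := fun (u : m.-tuple I) (v : n.-tuple I) =>
    (word_weight X phi delta u * word_weight X phi delta v)%E)); last first.
  by move=> u v _ _; rewrite mule_ge0// (word_weight_ge0 H).
apply: (@le_trans _ _ (\esum_(u in [set: m.-tuple I]) (Z delta n * word_weight X phi delta u))%E).
  apply: le_esum => u _; rewrite [leRHS]muleC; apply: esumZ_le => [|v].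
    exact: (word_weight_ge0 H).
  exact: (word_weight_ge0 H).
rewrite [leRHS]muleC; apply: esumZ_le => [|v]; first exact: (pressure_sum_ge0 H).
exact: (word_weight_ge0 H).
Qed.

(** One factor D to the power delta2 - delta1 is split off each term and bounded by the uniform
    contraction. *)
Lemma pressure_sum_scale_le delta1 delta2 n : 0 <= delta1 -> delta1 < delta2 ->
  (Z delta2 n <= ((s ^+ n) `^ (delta2 - delta1))%:E * Z delta1 n)%E.
Proof.
move=> d1 d12; apply: le_trans (esumZ_le _ _ _); last 2 first.
- by rewrite lee_fin powR_ge0.
- by move=> w; exact: (word_weight_ge0 H).
apply: le_esum => w _; apply: ge_ereal_sup => _ [x Xx <-].
have D0 : 0 < D w x by apply: (opnorm_word_gt0 H); exact: (cs_XV H).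
have Ds : D w x <= s ^+ n by have := opnorm_word_le H w Xx; rewrite size_tuple.
apply: (@le_trans _ _ (((s ^+ n) `^ (delta2 - delta1))%:E * (D w x `^ delta1)%:E)%E).
  rewrite -EFinM lee_fin -[in leLHS](subrK delta1 delta2) powRD; last first.
    by apply/implyP => _; rewrite gt_eqF.
  rewrite ler_wpM2r ?powR_ge0//; apply: ge0_ler_powR (Ds).
  - by rewrite subr_ge0 ltW.
  - by rewrite nnegrE ltW.
  - by rewrite nnegrE (le_trans (ltW D0) Ds).
by rewrite lee_wpmul2l ?lee_fin ?powR_ge0//; exact: word_weight_ge.
Qed.

(** Repeating one letter gives an exponential lower bound for the pressure sums, so their logarithms
    are real and bounded below linearly. *)
Lemma opnorm_nseq_ge i x n : X x -> (D [:: i] x / K) ^+ n <= D (nseq n i) x.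
Proof.
move=> Xx; have Vx := cs_XV H Xx.
have K0 : 0 < K := lt_le_trans ltr01 (cs_K1 H).
have k0 : 0 <= D [:: i] x / K by rewrite divr_ge0 ?(ltW K0)//; apply/ltW/(opnorm_word_gt0 H).
elim: n => [|n IH]; first by rewrite expr0 (opnorm_nil H).
have Vy := word_map_V H (nseq n i) Vx.
have h : D [:: i] x / K <= D [:: i] (word_map phi (nseq n i) x).
  by rewrite ler_pdivrMr// mulrC; exact: (cs_distortion H).
apply: (@le_trans _ _ (D [:: i] (word_map phi (nseq n i) x) * D (nseq n i) x)).
  by rewrite exprS; exact: (ler_pM k0 (exprn_ge0 n k0) h IH).
have -> : nseq n.+1 i = [:: i] ++ nseq n i by [].
by rewrite [leRHS](opnorm_cat H [:: i] (nseq n i) Vx).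
Qed.

Lemma pressure_sum_ge delta n (w : n.-tuple I) x : X x ->
  ((D w x `^ delta)%:E <= Z delta n)%E.
Proof.
move=> Xx; apply: le_trans (word_weight_ge delta w Xx) _.
apply: esum_ge; exists [set w]; first by split.
by rewrite fsbig_set1.
Qed.

(** Raising the exponent gains a factor exponentially small in n. The sums are then finite and
    positive, and Fekete's lemma provides the genuine limit that [limn] needs. *)
Lemma bounded_sum_pressure_lt0 (i : I) delta1 delta2 (M : R) :
  0 <= delta1 -> delta1 < delta2 ->
  (forall n, (1 <= n)%N -> (Z delta1 n <= M%:E)%E) ->
  (pressure X phi delta2 < 0)%E.
Proof.
move=> d1 d12 hM.
have d2 : 0 <= delta2 by rewrite (le_trans d1)// ltW.
have /andP[s0 s1] := cs_s01 H.
have K0 : 0 < K := lt_le_trans ltr01 (cs_K1 H).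
have [x0 /interior_subset Xx0] := cs_int H; have Vx0 := cs_XV H Xx0.
pose kap := D [:: i] x0 / K.
have kap0 : 0 < kap by rewrite divr_gt0//; exact: (opnorm_word_gt0 H).
have lowZ n : (((kap ^+ n) `^ delta2)%:E <= Z delta2 n)%E.
  have sz : size (nseq n i) == n by rewrite size_nseq.
  apply: le_trans (pressure_sum_ge delta2 (Tuple sz) Xx0).
  rewrite lee_fin; apply: ge0_ler_powR (opnorm_nseq_ge i n Xx0) => //.
  - by rewrite nnegrE exprn_ge0// ltW.
  - by rewrite nnegrE; apply/ltW/(opnorm_word_gt0 H).
have upZ n : (1 <= n)%N -> (Z delta2 n <= ((s ^+ n) `^ (delta2 - delta1) * M)%:E)%E.
  move=> n1; apply: le_trans (pressure_sum_scale_le n d1 d12) _.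
  by rewrite EFinM lee_wpmul2l ?lee_fin ?powR_ge0//; exact: hM.
pose z n := fine (Z delta2 n).
have zE n : (1 <= n)%N -> Z delta2 n = (z n)%:E.
  move=> n1; rewrite /z fineK// ge0_fin_numE ?(pressure_sum_ge0 H)//.
  by apply: le_lt_trans (upZ n n1) _; rewrite ltry.
have zl n : (1 <= n)%N -> (kap ^+ n) `^ delta2 <= z n.
  by move=> n1; rewrite -lee_fin -zE.
have zu n : (1 <= n)%N -> z n <= (s ^+ n) `^ (delta2 - delta1) * M.
  by move=> n1; rewrite -lee_fin -zE//; exact: upZ.
have z0 n : (1 <= n)%N -> 0 < z n.
  by move=> n1; apply: lt_le_trans (zl n n1); rewrite powR_gt0// exprn_gt0.
have M0 : 0 < M.
  have := lt_le_trans (z0 1%N isT) (zu 1%N isT).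
  by rewrite pmulr_rgt0// powR_gt0// exprn_gt0.
have cv : cvgn (fun n => n%:R^-1 * ln (z n)).
  apply: (@fekete _ _ (delta2 * ln kap)) => [m n m1 n1|n n1].
    have mn1 : (1 <= m + n)%N by rewrite addn_gt0 m1.
    rewrite -lnM ?posrE ?z0// ler_ln ?posrE ?mulr_gt0 ?z0//.
    by rewrite -lee_fin EFinM -!zE//; exact: pressure_sumD_le.
  have h : ln ((kap ^+ n) `^ delta2) <= ln (z n).
    by rewrite ler_ln ?posrE ?z0 ?powR_gt0 ?exprn_gt0// zl.
  by rewrite ln_powR lnXn// -mulr_natr mulrA in h.
pose c := (delta2 - delta1) * ln s.
have c0 : c < 0 by rewrite pmulr_rlt0 ?subr_gt0// ln_lt0// s0.
have c2 : 0 < - (c / 2) by lra.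
(* Half of the negative rate c is given up to absorb ln M / n for large n. *)
have lc : limn (fun n => n%:R^-1 * ln (z n)) <= c / 2.
  apply: limr_le => //; near=> n.
  have n1 : (1 <= n)%N by near: n; exists 1%N.
  have n0 : 0 < n%:R :> R by rewrite ltr0n.
  have nM : ln M / - (c / 2) <= n%:R by near: n; exact: nbhs_infty_ger.
  rewrite ler_pdivrMr// in nM.
  rewrite ler_pdivrMl//.
  have h : ln (z n) <= ln ((s ^+ n) `^ (delta2 - delta1) * M).
    by rewrite ler_ln ?posrE ?z0 ?mulr_gt0 ?powR_gt0 ?exprn_gt0// zu.
  rewrite lnM ?posrE ?powR_gt0 ?exprn_gt0// ln_powR lnXn// -mulr_natr mulrA -/c in h.
  by lra.
have : (fun n => ((n%:R^-1)%:E * lne (Z delta2 n))%E) @ \oo -->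
    (limn (fun n => n%:R^-1 * ln (z n)))%:E.
  have cE : EFin \o (fun n => n%:R^-1 * ln (z n)) @ \oo -->
      (limn (fun n => n%:R^-1 * ln (z n)))%:E.
    by apply: cvg_EFin; [exact: nearW|exact: cv].
  apply: cvg_trans cE; apply: near_eq_cvg; near=> k.
  have k1 : (1 <= k)%N by near: k; exists 1%N.
  by rewrite zE// lne_EFin ?z0.
move=> /(cvg_lim (@ereal_hausdorff R)) PE.
have -> : pressure X phi delta2 = (limn (fun n => n%:R^-1 * ln (z n)))%:E by exact: PE.
by rewrite lte_fin (le_lt_trans lc)// -oppr_gt0.
Unshelve. all: by end_near. Qed.

End Pressure.

(** * Finite subsystems *)

Lemma contracting_cifs_conformal_system (R : realType) (d : nat) (hd : (0 < d)%N)
    (I : Type) (X V : set 'rV[R]_d) (phi : I -> 'rV[R]_d -> 'rV[R]_d) (s : R) :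
  contracting_cifs X V phi s ->
  (forall i x, X x -> opnorm ('d (phi i) x) <= s) ->
  exists K, conformal_system X V phi s K.
Proof.
move=> H hs; have [K K1 hK] := cifs_distortion H; exists K.
have [eps [_ hdiff]] := cifs_diffeo H.
split=> //.
- exact: cifs_compact H.
- exact: cifs_int H.
- by move=> i x Xx; exact: (cifs_maps H (imageP (phi i) Xx)).
- exact: cifs_inj H.
- exact: cifs_s01 H.
- exact: cifs_contract H.
- by move=> i x Xx; exact: (cifs_osc_sub H (imageP (phi i) Xx)).
- move=> i j x y ij Xx Xy e.
  have : (phi i @` X° `&` phi j @` X°) (phi i x) by split; [exists x|exists y].
  by rewrite (cifs_osc_disj H ij).
- exact: cifs_V_open H.
- exact: cifs_V_connected H.
- exact: cifs_XV H.
- by move=> i x Vx; have [[fV _ _ _] _] := hdiff i; apply: fV; exists x.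
- by move=> i x Vx; have [[_ _ [dphi _] _] _] := hdiff i; exact: dphi.
- by move=> i; have [_] := hdiff i.
Qed.

Lemma word_map_blocks (T I J : Type) (phi : I -> T -> T) (B : J -> seq I) (w : seq J) :
  word_map (fun t => word_map phi (B t)) w = word_map phi (flatten (map B w)).
Proof. by elim: w => //= t w IH; rewrite word_map_cat -IH. Qed.

(** Distinct blocks of equal length are incomparable, whence the open set condition; words over the
    blocks are words over I, so K persists. *)
Lemma block_conformal_system (R : realType) (d : nat) (I J : eqType)
    (X V : set 'rV[R]_d) (phi : I -> 'rV[R]_d -> 'rV[R]_d) (s K : R)
    (B : J -> seq I) (n : nat) : (1 <= n)%N -> (forall t, size (B t) = n) ->
  injective B -> conformal_system X V phi s K ->
  conformal_system X V (fun t => word_map phi (B t)) s K.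
Proof.
move=> n1 Bn Binj H; have /andP[s0 s1] := cs_s01 H.
have sn t : s ^+ size (B t) <= s.
  by rewrite Bn -(prednK n1) exprS ler_piMr ?(ltW s0)// exprn_ile1// ltW.
split.
- exact: cs_dim H.
- exact: cs_compact H.
- exact: cs_int H.
- by move=> t x; exact: (word_map_X H).
- by move=> t; exact: (word_map_inj H).
- exact: cs_s01 H.
- move=> t x y Xx Xy; apply: le_trans (word_map_contract H (B t) Xx Xy) _.
  by rewrite ler_wpM2r// enorm_ge0.
- by move=> t x; exact: (word_map_int H).
- move=> t u x y tu; apply: (word_map_disjoint H); apply/andP.
  have tu' : B t <> B u by move=> /Binj.
  by split; apply/negP => /prefixP[z e]; apply: tu';
    have := congr1 size e; rewrite size_cat !Bn => /eqP;
    rewrite -[X in X == _]addn0 eqn_add2l eq_sym size_eq0 => /eqP z0;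
    rewrite e z0 cats0.
- exact: cs_V_open H.
- exact: cs_V_connected H.
- exact: cs_XV H.
- by move=> t x; exact: (word_map_V H).
- by move=> t x; exact: (word_map_diff H).
- by move=> t; exact: (word_map_conformal H).
- exact: cs_K1 H.
- by move=> w x y Vx Vy; rewrite word_map_blocks; exact: (cs_distortion H).
- by move=> t x Xx; apply: le_trans (sn t); exact: (opnorm_word_le H).
Qed.

Lemma word_map_subsystem (T : Type) (I : choiceType) (phi : I -> T -> T)
    (F : set I) (w : seq F) :
  word_map (subsystem phi (F := F)) w = word_map phi (map val w).
Proof. by elim: w => //= i w ->. Qed.

Lemma limit_set_subsystem (R : realType) (d : nat) (I : choiceType)
    (X : set 'rV[R]_d) (phi : I -> 'rV[R]_d -> 'rV[R]_d) (F : set I) :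
  limit_set X (subsystem phi (F := F)) `<=` limit_set X phi.
Proof.
move=> x [w _ xw]; exists (val \o w) => // m m1.
by have := xw m m1; rewrite word_map_subsystem /mkseq -map_comp.
Qed.

Lemma mkseq_blocks (I J : Type) (i0 : I) (B : J -> seq I) (n : nat) (w : nat -> J) m :
  (1 <= n)%N -> (forall t, size (B t) = n) ->
  mkseq (fun k => nth i0 (B (w (k %/ n)%N)) (k %% n)%N) (m * n) =
  flatten (map B (mkseq w m)).
Proof.
move=> n1 Bn; elim: m => [//|m IH].
rewrite mulSnr mkseqS map_rcons -cats1 flatten_cat /= cats0 -IH.
rewrite /mkseq iotaD map_cat add0n; congr (_ ++ _).
apply: (@eq_from_nth _ i0); first by rewrite size_map size_iota Bn.
move=> k; rewrite size_map size_iota => kn.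
rewrite (nth_map 0%N) ?size_iota// nth_iota//.
by rewrite divnMDl// divn_small// addn0 modnMDl modn_small.
Qed.

Lemma limit_set_blocks (R : realType) (d : nat) (I : choiceType) (J : Type)
    (X V : set 'rV[R]_d) (phi : I -> 'rV[R]_d -> 'rV[R]_d) (s K : R)
    (B : J -> seq I) (n : nat) (F : set I) :
  conformal_system X V phi s K -> (1 <= n)%N -> (forall t, size (B t) = n) ->
  (forall t i, i \in B t -> F i) ->
  limit_set X (fun t => word_map phi (B t)) `<=` limit_set X (subsystem phi (F := F)).
Proof.
move=> H n1 Bn BF x [w _ xw].
have [i0 _] : exists i, i \in B (w 0%N).
  have := Bn (w 0%N); case: (B (w 0%N)) => [n0|i u _]; first by rewrite -n0 in n1.
  by exists i; rewrite mem_head.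
pose v k := nth i0 (B (w (k %/ n)%N)) (k %% n)%N.
have vF k : v k \in F.
  by apply/mem_set/(BF (w (k %/ n)%N)); rewrite mem_nth// Bn ltn_mod.
exists (fun k => exist _ (v k) (vF k)) => // m m1.
rewrite word_map_subsystem /mkseq -map_comp -[map _ _]/(mkseq v m).
have [y Xy <-] := xw m m1.
rewrite word_map_blocks -(mkseq_blocks i0 w m n1 Bn) -/v.
(* As m blocks contain at least m letters, the cylinder of m blocks lies in that of the first m
   letters. *)
have mn : (m <= m * n)%N by rewrite leq_pmulr.
exists (word_map phi (drop m (mkseq v (m * n))) y); first exact: (word_map_X H).
rewrite -[LHS]/((word_map phi (mkseq v m) \o _) y) -word_map_cat.
by rewrite -(take_mkseq_le v mn) cat_take_drop.
Qed.

(** * Lower bound by finite subsystems *)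

Section LowerBound.
Context {R : realType} {d : nat} {I : countType}.
Context {X V : set 'rV[R]_d} {phi : I -> 'rV[R]_d -> 'rV[R]_d} {s K : R}.
Context (H : conformal_system X V phi s K).

Local Notation D w x := (opnorm ('d (word_map phi w) x)).

(** One factor K compares the supremum over X with the value at [x0], the other makes [c t] a lower
    bound on all of X. The threshold thus leaves a sum of at least 1 over finitely many blocks, and
    F collects their letters. *)
Lemma large_sum_finite_subsystem (delta : R) n : 0 <= delta -> (1 <= n)%N ->
  (((K * K) `^ delta)%:E < pressure_sum X phi delta n)%E ->
  exists F : set I, [/\ finite_set F, F !=set0 &
    (delta%:E <= hausdorff_dim (limit_set X (subsystem phi (F := F))))%E].
Proof.
move=> d0 n1 /ereal_sup_gt[_ [A [fA _] <-]].
rewrite fsbig_finite//= big_tnth => hA.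
have ul := finmap.fset_uniq (fset_set A).
set l := finmap.enum_fset (fset_set A) in ul hA.
pose T : finType := 'I_(size l).
pose B (t : T) : seq I := tnth (in_tuple l) t.
have {}hA : (((K * K) `^ delta)%:E < \sum_(t : T) word_weight X phi delta (B t))%E by exact: hA.
have K0 : 0 < K := lt_le_trans ltr01 (cs_K1 H).
have /andP[s0 s1] := cs_s01 H.
have [x0 /interior_subset Xx0] := cs_int H; have Vx0 := cs_XV H Xx0.
have Bn t : size (B t) = n by rewrite size_tuple.
have Binj : injective B by move=> t u /val_inj; exact: (tuple_uniqP (in_tuple l) ul).
have HB := block_conformal_system n1 Bn Binj H.
pose c t := D (B t) x0 / K.
have c0 t : 0 < c t by rewrite divr_gt0//; exact: (opnorm_word_gt0 H).
have c1 t : c t <= 1.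
  rewrite ler_pdivrMr// mul1r (le_trans _ (cs_K1 H))//.
  apply: le_trans (opnorm_word_le H _ Xx0) _.
  by rewrite exprn_ile1// ltW.
have cD t x : X x -> c t <= D (B t) x.
  move=> Xx; rewrite ler_pdivrMr// mulrC; apply: (cs_distortion H) => //.
  exact: (cs_XV H).
have sumc : 1 <= \sum_t c t `^ delta.
  have KK : 0 < (K * K) `^ delta by rewrite powR_gt0// mulr_gt0.
  rewrite -(ler_pM2l KK) mulr1 mulr_sumr -lee_fin -sumEFin.
  apply: le_trans (ltW hA) _; apply: lee_sum => t _.
  apply: ge_ereal_sup => _ [x Xx <-]; have Vx := cs_XV H Xx.
  have KK0 : 0 <= K * K by exact: mulr_ge0 (ltW K0) (ltW K0).
  rewrite lee_fin -(powRM delta KK0 (ltW (c0 t))).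
  have h : D (B t) x <= K * K * c t.
    rewrite -mulrA [K * c t]mulrC divfK ?gt_eqF//.
    exact: (cs_distortion H).
  apply: ge0_ler_powR h; rewrite ?nnegrE//.
    exact/ltW/(opnorm_word_gt0 H).
  exact: mulr_ge0 KK0 (ltW (c0 t)).
have [t0 _] : exists t : T, True.
  case: (pickP T) => [t _|T0]; first by exists t.
  by move: sumc; rewrite big_pred0// ler10.
exists [set i | i \in flatten [seq B t | t <- enum T]]; split.
- exact: finite_seq.
- have := Bn t0; case E : (B t0) => [|i u] nE; first by rewrite -nE in n1.
  exists i => /=; apply/flattenP; exists (B t0); last by rewrite E mem_head.
  by rewrite map_f// mem_enum.
(* If the eta-measure vanished for some eta < delta, then [c t <= 1] would keep the sum at exponent
   eta at least 1, against the positivity of the measure of the block limit set. *)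
apply: le_ereal_inf_tmp => _ [eta [eta0 hM] <-]; rewrite leNgt lte_fin.
apply/negP => ed.
have := hausdorff_measure_limit_set_neq0 HB eta0 (fun t => ltW (c0 t)) cD.
apply.
  apply: le_trans sumc _; apply: ler_sum => t _.
  by apply: ger_powR; rewrite ?c0 ?c1// ltW.
apply/le_anti; rewrite hausdorff_measure_ge0 andbT -hM.
apply: hausdorff_measure_subset; apply: (limit_set_blocks H n1 Bn) => t i ti /=.
by apply/flattenP; exists (B t) => //; rewrite map_f// mem_enum.
Qed.

(** Between the supremum S and h choose d1 < d2. The sums at d1 stay bounded, since otherwise a
    finite subsystem would have dimension at least d1 > S; so the pressure at d2 is negative,
    although d2 < h. *)
Lemma bowen_le_sup (i : I) :
  (ereal_inf [set delta%:E | delta in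
      [set delta : R | (0 <= delta)%R /\ (pressure X phi delta < 0)%E]] <=
    ereal_sup [set hausdorff_dim (limit_set X (subsystem phi (F:=F))) | F in
      [set F : set I | finite_set F /\ F !=set0]])%E.
Proof.
set h := ereal_inf _; set S := ereal_sup _.
have S0 : (0 <= S)%E.
  apply: le_trans (hausdorff_dim_ge0 (limit_set X (subsystem phi (F := [set i])))) _.
  apply: ereal_sup_ubound; exists [set i] => //; split; first exact: finite_set1.
  by exists i.
rewrite leNgt; apply/negP => Sh.
have [d1 [d2 [Sd1 d12 d2h]]] : exists a b : R, [/\ (S < a%:E)%E, a < b & (b%:E < h)%E].
  case: S S0 Sh => [a| |] S0 Sh; last by [].
    case: h Sh => [b| |] Sh; last by [].
      rewrite lte_fin in Sh; exists (a + (b - a) / 3), (a + (b - a) / 3 * 2).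
      by rewrite !lte_fin; split; lra.
    by exists (a + 1), (a + 2); rewrite !lte_fin ltry; split => //; lra.
  by rewrite ltNge leey in Sh.
have d10 : 0 <= d1 by rewrite -lee_fin (le_trans S0)// ltW.
have P2 : ~ (pressure X phi d2 < 0)%E.
  move=> P2; move: d2h; apply/negP; rewrite -leNgt; apply: ereal_inf_lbound.
  by exists d2 => //; split=> //; rewrite (le_trans d10)// ltW.
apply: P2; apply: (bounded_sum_pressure_lt0 H i (M := (K * K) `^ d1) d10 d12) => n n1.
rewrite leNgt; apply/negP => /(large_sum_finite_subsystem d10 n1)[F [fF F0 hF]].
have : (d1%:E <= S)%E by apply: le_trans hF _; apply: ereal_sup_ubound; exists F.
by rewrite leNgt Sd1.
Qed.

End LowerBound.

Theorem mainTheorem4 (R : realType) (d : nat) (hd : (0 < d)%N)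
    (I : countType) (hI : [set: I] !=set0)
    (X V : set 'rV[R]_d) (phi : I -> 'rV[R]_d -> 'rV[R]_d) (s : R)
    (hPhi : contracting_cifs X V phi s)
    (hderiv : forall (i : I) (x : 'rV[R]_d), X x -> opnorm ('d (phi i) x) <= s) :
  hausdorff_dim (limit_set X phi) =
    ereal_inf [set delta%:E | delta in
      [set delta : R | 0 <= delta /\ (pressure X phi delta < 0)%E]] /\
  ereal_inf [set delta%:E | delta in
      [set delta : R | 0 <= delta /\ (pressure X phi delta < 0)%E]] =
    ereal_sup [set hausdorff_dim (limit_set X (subsystem phi (F:=F))) | F in
      [set F : set I | finite_set F /\ F !=set0]].
Proof.
have [i _] := hI.
have [K H] := contracting_cifs_conformal_system hd hPhi hderiv.
have dim_le : (hausdorff_dim (limit_set X phi) <= ereal_inf [set delta%:E | delta in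
    [set delta : R | (0 <= delta)%R /\ (pressure X phi delta < 0)%E]])%E.
  apply: ereal_inf_le_tmp => _ [delta [d0 P0] <-]; exists delta => //; split=> //.
  apply: (hausdorff_measure_limit_set_eq0 H d0).
  exact: (pressure_lt0_sum_small H P0).
have sup_le : (ereal_sup [set hausdorff_dim (limit_set X (subsystem phi (F:=F))) | F in
    [set F : set I | finite_set F /\ F !=set0]] <= hausdorff_dim (limit_set X phi))%E.
  apply: ge_ereal_sup => _ [F _ <-]; apply: hausdorff_dim_subset.
  exact: limit_set_subsystem.
have le_sup := bowen_le_sup H i.
(* The three inequalities form a cycle. *)
split; apply/le_anti; rewrite ?dim_le ?le_sup /=.
- exact: le_trans le_sup sup_le.
- exact: le_trans sup_le dim_le.
Qed.
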